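(* Let $\mathcal K$ be a 3-dimensional simplicial complex embedded in $\mathbb R^3$ triangulating a closed bounded domain with Lipschitz boundary that is homeomorphic to a closed 3-ball. Then there exists a spanning tree of the 1-skeleton of $\mathcal K$ for which the Spanning Tree Technique (STT) terminates if and only if $\mathcal K$ is collapsible.
   Context: Simplices of $\mathcal K$ are oriented; $\mathbf C$ is the face–edge incidence matrix ($\pm1$ if $e\subset\partial f$ with sign given by orientations, $0$ otherwise). STT with input a spanning tree $T$ of the graph of vertices and edges of $\mathcal K$ (for a given face array $\mathbf i$): set $\mathbf h_e=0$ for edges $e$ of $T$, other edge values unknown; put all triangles in a list $L$; repeatedly choose a triangle $f\in L$ with two boundary edges $e_1,e_2$ of known value, set the value of its remaining boundary edge $e$ to $\mathbf h_e=(\mathbf C_{f,e})^{-1}(\mathbf i_f-\mathbf C_{f,e_1}\mathbf h_{e_1}-\mathbf C_{f,e_2}\mathbf h_{e_2})$, and remove $f$ from $L$. STT terminates if it never gets stuck with edges of unknown value remaining and no such triangle available, i.e. every edge eventually receives a value. An elementary collapse removes a pair $(\sigma,\tau)$ of cells with $\sigma\subset\tau$, $\dim\sigma=\dim\tau-1$, $\tau$ the only cell properly containing $\sigma$; $\mathcal K$ is collapsible if a finite sequence of elementary collapses reduces it to a single vertex. *)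

(* Defs.v *)
From HB Require Import structures.
From mathcomp Require Import all_boot all_order all_algebra.
From mathcomp Require Import all_classical all_reals all_analysis.
From Stdlib Require Import Relations.
Set Implicit Arguments. Unset Strict Implicit. Unset Printing Implicit Defensive.
Import Order.TTheory GRing.Theory Num.Theory.
Import numFieldNormedType.Exports.
Local Open Scope ring_scope.

Section Combinatorics.
Variable V : finType.
Implicit Types (K T : {set {set V}}).

Definition is_simplicial_complex K : Prop :=
  (forall s, s \in K -> (0 < #|s|)%N) /\
  (forall s t : {set V}, s \in K -> t \subset s -> (0 < #|t|)%N -> t \in K).

Definition all_vertices K : Prop := forall v : V, [set v] \in K.

Definition dim3 K : Prop :=
  (forall s, s \in K -> #|s| <= 4)%N /\ (exists2 s, s \in K & #|s| = 4%N).

Definition edges K : {set {set V}} := [set s in K | #|s| == 2%N].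
Definition triangles K : {set {set V}} := [set s in K | #|s| == 3%N].

Definition adj T : rel V := fun u v => (u != v) && ([set u; v] \in T).

Definition spanning_tree K T : Prop :=
  [/\ T \subset edges K,
      (forall u v : V, connect (adj T) u v) &
      (forall c : seq V, uniq c -> (3 <= size c)%N -> ~~ cycle (adj T) c)].

(* The Spanning Tree Technique.  A state is (set of edges of known value,
   list L of remaining triangles).  Edge values are not recorded: since
   C_{f,e} = +-1 is always invertible, the values never influence which
   steps are possible, hence never influence termination. *)
Definition stt_state := ({set {set V}} * {set {set V}})%type.

Inductive stt_step : stt_state -> stt_state -> Prop :=
| STTStep (kn L : {set {set V}}) (f e1 e2 e : {set V}) :
    f \in L ->
    e1 \subset f -> e2 \subset f -> e \subset f ->
    #|e1| = 2%N -> #|e2| = 2%N -> #|e| = 2%N ->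
    e1 != e2 -> e != e1 -> e != e2 ->
    e1 \in kn -> e2 \in kn ->
    stt_step (kn, L) (e |: kn, L :\ f).

Definition stt_init K T : stt_state := (T, triangles K).

Definition stt_terminates K T : Prop :=
  forall st, clos_refl_trans _ stt_step (stt_init K T) st ->
    (forall st', ~ stt_step st st') -> edges K \subset st.1.

Definition elementary_collapse K K' : Prop :=
  exists sigma tau : {set V},
    [/\ sigma \in K /\ tau \in K, sigma \proper tau,
        #|tau| = #|sigma|.+1,
        (forall rho, rho \in K -> sigma \proper rho -> rho = tau) &
        K' = K :\ sigma :\ tau].

Definition collapsible K : Prop :=
  exists v : V, clos_refl_trans _ elementary_collapse K [set [set v]].

End Combinatorics.

Local Open Scope classical_set_scope.
Section Geometry.
Variable R : realType.
Local Notation pt := 'rV[R]_3.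

Definition c0 : 'I_3 := @Ordinal 3 0 isT.
Definition c1 : 'I_3 := @Ordinal 3 1 isT.
Definition c2 : 'I_3 := @Ordinal 3 2 isT.
Definition coord (x : pt) (i : 'I_3) : R := x ord0 i.

Variable V : finType.

Definition hull (p : V -> pt) (s : {set V}) : set pt :=
  [set x | exists t : V -> R, [/\ (forall v, 0 <= t v),
      \sum_(v in s) t v = 1 & x = \sum_(v in s) t v *: p v]].

Definition affinely_independent (p : V -> pt) (s : {set V}) : Prop :=
  forall c : V -> R, \sum_(v in s) c v = 0 -> \sum_(v in s) c v *: p v = 0 ->
    forall v, v \in s -> c v = 0.

Definition geometric_complex (K : {set {set V}}) (p : V -> pt) : Prop :=
  (forall s, s \in K -> affinely_independent p s) /\
  (forall s t : {set V}, s \in K -> t \in K -> hull p s `&` hull p t = hull p (s :&: t)).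

Definition realization (K : {set {set V}}) (p : V -> pt) : set pt :=
  \bigcup_(s in [set s | s \in K]) hull p s.

Definition closed_ball3 : set pt :=
  [set x | coord x c0 ^+ 2 + coord x c1 ^+ 2 + coord x c2 ^+ 2 <= 1].

Definition homeomorphic (A B : set pt) : Prop :=
  exists (f g : pt -> pt),
    [/\ (forall x, A x -> B (f x)) /\ (forall y, B y -> A (g y)),
        (forall x, A x -> g (f x) = x), (forall y, B y -> f (g y) = y),
        {within A, continuous f} & {within B, continuous g}].

Definition orthogonal3 (Q : 'M[R]_3) : Prop := Q *m Q^T = 1%:M.

(* Open set O has Lipschitz boundary (Grisvard, Def. 1.2.1.1): around each
   boundary point, after an orthogonal change of coordinates, O coincides
   inside a box with the subgraph of a Lipschitz function. *)
Definition lipschitz_boundary (O : set pt) : Prop :=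
  forall x, closure O x -> ~ O x ->
  exists (Q : 'M[R]_3) (a b L : R) (phi : R -> R -> R),
    [/\ orthogonal3 Q, 0 < a /\ 0 < b,
        (forall s t s' t', (phi s t - phi s' t') ^+ 2 <=
                            L ^+ 2 * ((s - s') ^+ 2 + (t - t') ^+ 2)) &
        forall z, let y := (z - x) *m Q in
          `|coord y c0| < a -> `|coord y c1| < a -> `|coord y c2| < b ->
          (O z <-> coord y c2 < phi (coord y c0) (coord y c1))].

Definition closed_lipschitz_domain (D : set pt) : Prop :=
  [/\ closed D, bounded_set D, D = closure (interior D),
      connected (interior D) & lipschitz_boundary (interior D)].

End Geometry.

(* Main.v *)
(* Chains are taken modulo 2.  A collapse to a vertex, read backwards, builds a
   spanning tree from its (vertex, edge) pairs, and each (edge, triangle) pair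
   is a step of the algorithm, so the values propagate to all edges.

   Conversely, a run of the algorithm selects a set F of triangles that carries
   no 2-cycle and whose boundaries, together with the tree, generate all
   1-cycles.  The boundary of the set of remaining tetrahedra is a nonzero
   2-cycle, hence contains a triangle outside F; it is a free face, because a
   triangle lies on at most two tetrahedra.  So all tetrahedra can be collapsed
   without touching F.  A triangle outside F that survived would close up to a
   2-cycle which is not a boundary; since every 2-cycle of K bounds, there is
   none, and what is left collapses along F in reverse order and then along the
   tree.

   That a 2-cycle z bounds is where the topology enters.  Its winding parity is
   locally constant off z and vanishes far away.  If it vanishes outside |K|,
   then z is the boundary of the set of tetrahedra of odd parity.  Otherwise |K|
   has a bounded hole U.  Being homeomorphic to a ball, |K| is a retract of
   space (Tietze), and the map equal to the retraction on U and to the identity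
   elsewhere is continuous, is the identity far away and misses a point of U,
   which contradicts Sperner's lemma. *)

Require Import Defs.
From HB Require Import structures.
From mathcomp Require Import all_boot all_order all_algebra.
From mathcomp Require Import all_classical all_reals all_analysis.
From mathcomp Require Import lra ring.
From Stdlib Require Import Relations Btauto.
Set Implicit Arguments.
Unset Strict Implicit.
Unset Printing Implicit Defensive.

(** * From collapses to spanning trees *)

(** Ordered by time of discovery, the new edges and the triangles that reveal them have a triangular
    incidence matrix modulo 2: a new edge lies on no earlier used triangle. Both properties of F,
    and the freeness of the edges in the reversed run, come from this.

    The geometric obstacle is that the winding parity behaves well only at points in general
    position, off the affine span of any three of the vertices and of an auxiliary apex [q]. The
    segment joining two such points may still meet a line through an edge, so constancy is proved by
    joining both points to a third one. For the same reason a hole is not defined pointwise but as a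
    union of convex open sets, each containing a generic point of odd parity.

    All geometric facts rest on one count: a segment in general position meets an odd number of
    facets of a tetrahedron iff exactly one of its ends lies inside. It is applied to the tetrahedra
    of K, and to the cones with apex [q] over the triangles of z. *)

Section SttOfCollapse.
Import mathcomp.boot.fintype mathcomp.boot.finset.
Variable V : finType.
Implicit Types (K T kn L : {set {set V}}) (s t e f : {set V}).

(** Sets that the propagation rule cannot enlarge. Quantifying over all of them in [generating_tree]
    frees the argument from the list and from the order of the steps. *)
Definition triangle_closed K kn := forall f e1 e2 e,
  f \in triangles K -> e1 \subset f -> e2 \subset f -> e \subset f ->
  #|e1| = 2 -> #|e2| = 2 -> #|e| = 2 ->
  e1 != e2 -> e != e1 -> e != e2 -> e1 \in kn -> e2 \in kn -> e \in kn.

Definition acyclic T :=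
  forall c : seq V, uniq c -> 3 <= size c -> ~~ cycle (adj T) c.

(** Connectivity is asked only between vertices of [K]: collapses remove vertices while the type [V]
    stays fixed. *)
Definition generating_tree K T := [/\ T \subset edges K,
  forall u v, [set u] \in K -> [set v] \in K -> connect (adj T) u v,
  acyclic T &
  forall kn, T \subset kn -> triangle_closed K kn -> edges K \subset kn].

Lemma adjC T u v : adj T u v = adj T v u.
Proof. by rewrite /adj eq_sym setUC. Qed.

Lemma adj_sub T T' : T \subset T' -> subrel (adj T) (adj T').
Proof. by move=> /subsetP sTT' u v /andP[uv /sTT' ?]; apply/andP. Qed.

Lemma elementary_collapse_sub K K' : elementary_collapse K K' -> K' \subset K.
Proof.
case=> s [t [_ _ _ _ ->]]; apply/subsetP=> x.
by rewrite !inE => /andP[_ /andP[_ ->]].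
Qed.

Lemma elementary_collapse_complex K K' : is_simplicial_complex K ->
  elementary_collapse K K' -> is_simplicial_complex K'.
Proof.
move=> [Kp Kd] [s [t [[sK tK] st cst free ->]]]; split=> [x|x y].
  by rewrite !inE => /andP[_ /andP[_ /Kp]].
rewrite !inE => /and3P[xt xs xK] yx y0; rewrite (Kd x) // andbT.
apply/andP; split; apply: contraNneq xt => yE; apply/eqP/free => //.
  by rewrite (proper_sub_trans st) // -yE.
by rewrite properEneq eq_sym xs -yE.
Qed.

(** The removed vertex comes back as a leaf: [t] is the only edge through it, so adding [t] to the
    tree reaches it and creates no cycle. *)
Lemma generating_tree_vertex K K' s t T : is_simplicial_complex K ->
  s \in K -> t \in K -> s \proper t -> #|t| = #|s|.+1 ->
  (forall r, r \in K -> s \proper r -> r = t) -> K' = K :\ s :\ t ->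
  #|s| = 1 -> generating_tree K' T -> generating_tree K (t |: T).
Proof.
move=> [Kp Kd] sK tK st cst free KE /eqP/cards1P[v sE] [TE Tc Ta Tg].
have tv : v \in t by rewrite -sub1set -sE proper_sub.
have ct : #|t| = 2 by rewrite cst sE cards1.
have /cards1P[w tw] : #|t :\ v| == 1.
  by move: (cardsD1 v t); rewrite tv ct add1n => -[<-].
have tE : t = [set v; w] by rewrite -tw setD1K.
have wv : w != v by move: (set11 w); rewrite -tw !inE => /andP[].
have K'K : K' \subset K by rewrite KE; apply/subsetP=> x; rewrite !inE => /and3P[].
have vtxK' u : u != v -> [set u] \in K -> [set u] \in K'.
  move=> uv uK; rewrite KE !inE uK andbT sE; apply/andP; split.
    by apply/eqP => /(congr1 (fun A : {set V} => #|A|)); rewrite cards1 ct.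
  by apply: contraNneq uv => /set1_inj ->.
have eKt e : e \in edges K -> v \in e -> e = t.
  rewrite inE => /andP[eK /eqP ce] ve; apply: free => //.
  rewrite properEcard sE sub1set ve /= cards1 ce //.
have Tv e : e \in T -> v \notin e.
  move=> eT; apply/negP => ve; move: (subsetP TE _ eT); rewrite inE => /andP[eK' ce].
  have eE : e = t by apply: eKt => //; rewrite inE ce (subsetP K'K).
  by move: eK'; rewrite KE eE !inE eqxx.
have eK'K e : e \in edges K -> e != t -> e \in edges K'.
  rewrite !inE KE !inE => /andP[-> /eqP ce] -> /=; rewrite ce eqxx !andbT.
  by apply/eqP => es; move: ce; rewrite es sE cards1.
have adjv u : adj (t |: T) v u -> u = w.
  move=> /andP[vu]; rewrite !inE => /orP[/eqP E|/Tv]; last by rewrite !inE eqxx.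
  have : u \in t by rewrite -E !inE eqxx orbT.
  by rewrite tE !inE eq_sym (negPf vu) /= => /eqP.
have wK' : [set w] \in K'.
  apply: vtxK' => //; apply: (Kd t) => //; last by rewrite cards1.
  by rewrite sub1set tE !inE eqxx orbT.
have adjvw : adj (t |: T) v w by rewrite /adj eq_sym wv -tE !inE eqxx.
have csym : connect_sym (adj (t |: T)).
  by apply: sym_connect_sym => x y; rewrite adjC.
have cT x y : connect (adj T) x y -> connect (adj (t |: T)) x y.
  by apply: connect_sub => a b ab; apply: connect1; apply: adj_sub ab; apply: subsetUr.
have cw u : [set u] \in K -> connect (adj (t |: T)) w u.
  have [-> _|uv uK] := eqVneq u v; first by rewrite csym connect1.
  by apply/cT/Tc => //; apply: vtxK'.
split.
- apply/subsetP => e; rewrite !inE => /orP[/eqP->|/(subsetP TE)].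
    by rewrite tK ct.
  by rewrite inE => /andP[/(subsetP K'K) -> ->].
- move=> x y xK yK; apply: connect_trans (cw _ yK).
  by rewrite csym cw.
- move=> c uc sc; apply/negP => cc.
  have [vc|vc] := boolP (v \in c); last first.
    have ac : all (mem c) c by apply/seq.allP => x.
    apply: (negP (Ta c uc sc)); apply: (sub_in_cycle _ ac cc).
    move=> x y xc yc /andP[xy]; rewrite !inE => /orP[/eqP E|xyT]; last by apply/andP.
    have : v \in [set x; y] by rewrite E.
    by rewrite !inE => /orP[]/eqP E'; move: vc; rewrite E' ?xc ?yc.
  (* Once the cycle starts at [v], its second and its last vertex are neighbours of [v], hence both
     equal to [w], against [uniq]. *)
  have [i c' ci] := rot_to vc.
  move: cc uc sc; rewrite -(rot_cycle i) -(rot_uniq i) -(size_rot i) ci.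
  case: c' {ci} => [|a c'] //; case/lastP: c' => [|c' b] //.
  rewrite /= rcons_path last_rcons => /andP[/adjv -> /andP[_]].
  by rewrite adjC => /adjv ->; rewrite mem_rcons inE eqxx andbF.
- move=> kn Tkn ckn; apply/subsetP => e eK.
  have [->|et] := eqVneq e t; first by apply: (subsetP Tkn); rewrite !inE eqxx.
  apply: (subsetP (Tg kn _ _)); last exact: eK'K.
    by apply: subset_trans Tkn; apply: subsetUr.
  move=> f e1 e2 e3 fK; apply: ckn; move: fK; rewrite !inE.
  by move=> /andP[/(subsetP K'K) -> ->].
Qed.

(** The tree is unchanged: the two other edges of [t] survive in [K'], so they become known, and [t]
    passes the value on to [s]. *)
Lemma generating_tree_edge K K' s t T : is_simplicial_complex K ->
  s \in K -> t \in K -> s \proper t -> #|t| = #|s|.+1 ->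
  K' = K :\ s :\ t -> #|s| = 2 -> generating_tree K' T -> generating_tree K T.
Proof.
move=> [Kp Kd] sK tK st cst KE cs [TE Tc Ta Tg].
have K'K : K' \subset K by rewrite KE; apply/subsetP=> x; rewrite !inE => /and3P[].
have ct : #|t| = 3 by rewrite cst cs.
split=> //.
- apply: (subset_trans TE); apply/subsetP => e.
  by rewrite !inE => /andP[/(subsetP K'K) -> ->].
- by move=> u v uK vK; apply: Tc; rewrite KE !inE ?uK ?vK andbT; apply/andP;
   split; apply/eqP => /(congr1 (fun A : {set V} => #|A|)); rewrite cards1 ?cs ?ct.
move=> kn Tkn ckn.
have sub : edges K' \subset kn.
  apply: Tg => // f e1 e2 e3 fK; apply: ckn; move: fK; rewrite !inE.
  by move=> /andP[/(subsetP K'K) -> ->].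
have K'in e : e \in K -> #|e| = 2 -> e != s -> e \in kn.
  move=> eK ce es; apply: (subsetP sub); rewrite inE ce KE !inE eK es !andbT.
  by apply/eqP => E; move: ce; rewrite E ct.
apply/subsetP => e; rewrite inE => /andP[eK /eqP ce].
have [->{e eK ce}|es] := eqVneq e s; last exact: K'in.
have /cards2P[a [b [ab sE]]] : #|s| == 2 by rewrite cs.
(* [c] is the vertex of [t] opposite to [s]; the other two edges of [t] are those through [c]. *)
have /properP[_ [c ct' cs']] := st.
have [ca cb] : c != a /\ c != b.
  by move: cs'; rewrite sE !inE negb_or => /andP.
have at' : a \in t by apply: (subsetP (proper_sub st)); rewrite sE !inE eqxx.
have bt' : b \in t by apply: (subsetP (proper_sub st)); rewrite sE !inE eqxx orbT.
have ca2 : [set c; a] \subset t by apply/subsetP => x /set2P[]->.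
have cb2 : [set c; b] \subset t by apply/subsetP => x /set2P[]->.
have nca : [set c; a] != s by apply: contraNneq cs' => <-; rewrite !inE eqxx.
have ncb : [set c; b] != s by apply: contraNneq cs' => <-; rewrite !inE eqxx.
have cca : #|[set c; a]| = 2 by rewrite cards2 ca.
have ccb : #|[set c; b]| = 2 by rewrite cards2 cb.
apply: (ckn t [set c; a] [set c; b]) => //; rewrite ?[s == _]eq_sym //.
- by rewrite inE tK ct.
- exact: proper_sub.
- apply/eqP => /setP/(_ a); rewrite !inE eqxx orbT (eq_sym a c) (negPf ca).
  by rewrite (negPf ab).
- by apply: K'in => //; apply: (Kd t) => //; rewrite cca.
- by apply: K'in => //; apply: (Kd t) => //; rewrite ccb.
Qed.

(** Vertices and edges are untouched, and a set closed for the triangles of [K] is closed for the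
    fewer ones of [K']. *)
Lemma generating_tree_high K K' s t T :
  s \in K -> t \in K -> #|t| = #|s|.+1 ->
  K' = K :\ s :\ t -> 3 <= #|s| -> generating_tree K' T -> generating_tree K T.
Proof.
move=> sK tK cst KE cs [TE Tc Ta Tg].
have K'K : K' \subset K by rewrite KE; apply/subsetP=> x; rewrite !inE => /and3P[].
have low e : #|e| < 3 -> (e \in K') = (e \in K).
  move=> ce; rewrite KE !inE; case: (e \in K); rewrite ?andbF // !andbT.
  apply/andP; split; apply: contraTneq ce => ->; rewrite -leqNgt ?cst //; exact: leqW.
have eE : edges K = edges K'.
  by apply/setP => e; rewrite !inE; case: eqP => [ce|]; rewrite ?andbF ?andbT // low ?ce.
split=> //; rewrite ?eE //.
- by move=> u v uK vK; apply: Tc; rewrite low ?cards1.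
- move=> kn Tkn ckn; apply: Tg => // f e1 e2 e3 fK; apply: ckn.
  by move: fK; rewrite !inE => /andP[/(subsetP K'K) -> ->].
Qed.

Lemma collapse_generating_tree K v : is_simplicial_complex K ->
  clos_refl_trans _ (@elementary_collapse V) K [set [set v]] ->
  exists T, generating_tree K T.
Proof.
move=> + cl; have H := clos_rt_rt1n _ _ _ _ cl; move: H => {cl}.
move PE: [set [set v]] => P H.
elim: H PE => {K P} [K|K K' P KK' _ IH] E cK.
  exists set0; split=> [|a b||kn _ _].
  - exact: sub0set.
  - by rewrite -E !inE => /eqP/set1_inj -> /eqP/set1_inj ->.
  - move=> [|x [|y c]] //= _ _; rewrite /adj inE andbF //.
  - apply/subsetP => e; rewrite -E !inE => /andP[/eqP->]; by rewrite cards1.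
have [T gT] := IH E (elementary_collapse_complex cK KK').
case: KK' => s [t [[sK tK] st cst free KE]].
have s0 : 0 < #|s| by apply: cK.1.
case cs : #|s| s0 => [|[|[|n]]] // _.
- by exists (t |: T); exact: (generating_tree_vertex cK sK tK st cst free KE cs gT).
- by exists T; exact: (generating_tree_edge cK sK tK st cst KE cs gT).
- by exists T; apply: (generating_tree_high sK tK cst KE _ gT); rewrite cs.
Qed.

(** A set with three elements has only three subsets with two elements. *)
Lemma triangle_edges f e1 e2 e e' : #|f| = 3 ->
  e1 \subset f -> e2 \subset f -> e \subset f -> e' \subset f ->
  #|e1| = 2 -> #|e2| = 2 -> #|e| = 2 -> #|e'| = 2 ->
  e1 != e2 -> e != e1 -> e != e2 -> [|| e' == e, e' == e1 | e' == e2].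
Proof.
move=> cf s1 s2 s3 s4 c1 c2 c3 c4 n12 n31 n32; apply: contraT.
rewrite !negb_or => /and3P[ne n1 n2].
set D := [set B : {set V} | (B \subset f) && (#|B| == 2)].
have cD : #|D| = 3 by rewrite cards_draws cf.
have ic : #|[set e1; e2; e; e']| = 4.
  rewrite -!setUA !cardsU1 cards1 !inE !negb_or n12.
  by rewrite ![_ == e]eq_sym ![_ == e']eq_sym n31 n32 n1 n2 ne.
have : [set e1; e2; e; e'] \subset D.
  by rewrite !subUset !sub1set !inE s1 s2 s3 s4 c1 c2 c3 c4 !eqxx.
by move=> /subset_leq_card; rewrite ic cD.
Qed.

(** A triangle leaves the list only when its last edge receives a value. Hence the known edges of a
    stuck state are closed: a triangle with two known edges either allows a step or was removed
    earlier. *)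
Lemma stt_invariant K T st :
  clos_refl_trans _ (@stt_step V) (stt_init K T) st ->
  [/\ T \subset st.1, st.2 \subset triangles K &
   forall f e, f \in triangles K -> f \notin st.2 -> e \subset f -> #|e| = 2 -> e \in st.1].
Proof.
move=> cl; have := clos_rt_rtn1 _ _ _ _ cl; elim=> [|st' st'' step _ [IH1 IH2 IH3]].
  by split=> //= f e fK; rewrite fK.
case: step IH1 IH2 IH3 => kn L f e1 e2 e fL s1 s2 s3 c1 c2 c3 n12 n31 n32 k1 k2 /=.
move=> IH1 IH2 IH3; split.
- by apply: (subset_trans IH1); apply: subsetUr.
- by apply: subset_trans IH2; apply: subsetDl.
move=> g e' gK; rewrite !inE negb_and negbK => /orP[/eqP gf|gL] e'g ce'; last first.
  by rewrite (IH3 g) ?orbT.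
have cf : #|f| = 3 by move: (subsetP IH2 f fL); rewrite inE => /andP[_ /eqP].
rewrite gf in e'g.
by have /or3P[] := triangle_edges cf s1 s2 s3 e'g c1 c2 c3 ce' n12 n31 n32;
  move=> /eqP->; rewrite ?eqxx ?k1 ?k2 ?orbT.
Qed.

Lemma generating_tree_stt K T : is_simplicial_complex K -> all_vertices K ->
  generating_tree K T -> spanning_tree K T /\ stt_terminates K T.
Proof.
move=> cK vK [TE Tc Ta Tg]; split; first by split=> // u v; apply: Tc.
move=> [kn L] /stt_invariant[/= Tkn LK inv] stuck; apply: Tg => //.
move=> f e1 e2 e fK s1 s2 s3 c1 c2 c3 n12 n31 n32 k1 k2.
have [fL|fL] := boolP (f \in L); last exact: inv fL s3 c3.
by case: (stuck (e |: kn, L :\ f)); apply: (STTStep (e1 := e1) (e2 := e2)).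
Qed.

Lemma collapsible_stt K : is_simplicial_complex K -> all_vertices K ->
  collapsible K -> exists T, spanning_tree K T /\ stt_terminates K T.
Proof.
move=> cK vK [v /(collapse_generating_tree cK)[T /(generating_tree_stt cK vK)]].
by exists T.
Qed.

End SttOfCollapse.

(** * Chains modulo 2 *)

Section CollapseOfStt.
Import mathcomp.boot.fintype mathcomp.boot.finset.
Variable V : finType.
Implicit Types (K T kn L S z c F : {set {set V}}) (s t e f : {set V}).

(** Coefficient of [f] in the boundary of the chain [S] modulo 2, meant for members of [S] with one
    vertex more than [f]. *)
Definition bd S f : bool := \big[addb/false]_(s in S) (f \subset s).

Definition tetrahedra K : {set {set V}} := [set s in K | #|s| == 4].

Definition two_cycle z := forall e, #|e| = 2 -> bd z e = false.

(** This is $H_2(K;\mathbb Z/2)=0$, with chains written as sets of simplices; [no_three_cycle] is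
    likewise $H_3(K;\mathbb Z/2)=0$. *)
Definition bounding K := forall z, z \subset triangles K -> two_cycle z ->
  exists2 S : {set {set V}}, S \subset tetrahedra K & forall f, #|f| = 3 -> bd S f = (f \in z).

Definition no_three_cycle K := forall S, S \subset tetrahedra K -> S != set0 ->
  exists2 f : {set V}, #|f| = 3 & bd S f.

Definition pseudomanifold K := forall f, #|f| = 3 ->
  #|[set t in tetrahedra K | f \subset t]| <= 2.

Lemma bd0 f : bd set0 f = false.
Proof. by rewrite /bd big_set0. Qed.

Lemma bd_mem S f : bd S f = \big[addb/false]_s ((s \in S) && (f \subset s)).
Proof. by rewrite /bd big_mkcond; apply: eq_bigr => s _; case: (s \in S). Qed.

Lemma bd_symdiff c S f : bd [set x | (x \in c) (+) (x \in S)] f = bd c f (+) bd S f.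
Proof.
rewrite !bd_mem -big_split; apply: eq_bigr => s _; rewrite inE.
by case: (s \in c); case: (s \in S); case: (f \subset s).
Qed.

Lemma bd_setD1 S s f : s \in S -> bd S f = (f \subset s) (+) bd (S :\ s) f.
Proof. by move=> sS; rewrite /bd (big_setD1 s). Qed.

Lemma bd_setU1 S s f : s \notin S -> bd (s |: S) f = (f \subset s) (+) bd S f.
Proof. by move=> sS; rewrite /bd big_setU1. Qed.

Lemma big_addb_odd (I : finType) (P Q : pred I) :
  \big[addb/false]_(i | P i) Q i = odd #|[set i | P i && Q i]|.
Proof.
rewrite -sum1_card (big_morph odd oddD (erefl _)) big_mkcond [RHS]big_mkcond.
by apply: eq_bigr => i _; rewrite inE; case: (P i); case: (Q i).
Qed.

(* If [e] lies in [t], exactly two faces with [k + 1] vertices lie between them. *)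
Lemma bd_faces t e k : #|e| = k -> #|t| = k.+2 ->
  bd [set f : {set V} | (#|f| == k.+1) && (f \subset t)] e = false.
Proof.
move=> ce ct; rewrite /bd big_addb_odd.
have [et|net] := boolP (e \subset t); last first.
  rewrite (_ : [set _ | _] = set0) ?cards0 //; apply/setP => f; rewrite !inE.
  apply/negbTE/negP => /andP[/andP[_ ft] ef]; case/negP: net; exact: subset_trans ft.
rewrite (_ : [set _ | _] = [set x |: e | x in t :\: e]); last first.
  apply/setP => f; rewrite !inE; apply/idP/imsetP.
    move=> /andP[/andP[/eqP cf ft] ef].
    have /cards1P[x fx] : #|f :\: e| == 1.
      by rewrite cardsD (setIidPr ef) ce cf subSn // subnn.
    exists x; last by rewrite -fx setUC -[in LHS](setID f e) (setIidPr ef).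
    have : x \in f :\: e by rewrite fx set11.
    by rewrite !inE => /andP[-> /(subsetP ft) ->].
  move=> [x]; rewrite !inE => /andP[xe xt] ->.
  by rewrite cardsU1 xe ce eqxx /= subUset sub1set xt et subsetUr.
have inj : {in t :\: e &, injective (fun x => x |: e)}.
  move=> x y; rewrite !inE => /andP[xe _] /andP[ye _] /setP/(_ x).
  by rewrite !inE eqxx /= (negPf xe) orbF => /esym/eqP.
by rewrite (card_in_imset inj) cardsD (setIidPr et) ce ct -addn2 addKn.
Qed.

(** This is $\partial\partial=0$: exchanging the sums reduces it to a single simplex, which is
    [bd_faces]. *)
Lemma bd_bd S k e : #|e| = k -> (forall t, t \in S -> #|t| = k.+2) ->
  bd [set f : {set V} | (#|f| == k.+1) && bd S f] e = false.
Proof.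
move=> ce cS; rewrite bd_mem.
transitivity (\big[addb/false]_(t in S)
    bd [set f : {set V} | (#|f| == k.+1) && (f \subset t)] e).
  under [RHS]eq_bigr => t _ do rewrite bd_mem.
  rewrite exchange_big; apply: eq_bigr => f _; rewrite inE [bd S f]/bd.
  under [RHS]eq_bigr => t _ do rewrite inE.
  case: (#|f| == k.+1); last by rewrite /= big1.
  case: (e \subset f); last by rewrite andbF big1 // => t _; rewrite andbF.
  by rewrite andbT; apply: eq_bigr => t _; rewrite andbT.
by rewrite big1 // => t tS; apply: bd_faces => //; apply: cS.
Qed.

(** Without a leaf, a simple path can always be prolonged at its head, until it has more vertices
    than [V]. *)
Lemma acyclic_leaf T : T != set0 -> (forall e, e \in T -> #|e| = 2) -> acyclic T ->
  exists v e, [/\ e \in T, v \in e & forall e', e' \in T -> v \in e' -> e' = e].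
Proof.
move=> /set0Pn[e0 e0T] cT aT; apply: contrapT => noleaf.
have other v e : e \in T -> v \in e -> exists w, [/\ w != v, [set v; w] \in T & [set v; w] != e].
  move=> eT ve; apply: contrapT => now; apply: noleaf; exists v, e; split=> // e' e'T ve'.
  apply: contrapT => /eqP ne; apply: now.
  have /eqP/cards2P[a [b [ab eE]]] := cT _ e'T.
  move: ve'; rewrite eE !inE => /orP[]/eqP vE.
    by exists b; rewrite vE -eE eq_sym.
  by exists a; rewrite vE setUC -eE.
have long n : exists x y p, [/\ uniq [:: x, y & p], path (adj T) x (y :: p) & size p = n].
  elim: n => [|n [x [y [p [up pp sp]]]]].
    have /eqP/cards2P[a [b [ab eE]]] := cT _ e0T.
    by exists a, b, [::]; rewrite /= !inE ab /adj ab -eE e0T.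
  have /andP[xy xyT] : adj T x y by case/andP: pp.
  have [|w [wx xwT ne]] := other x _ xyT; first by rewrite !inE eqxx.
  have wy : w != y by apply: contraNneq ne => ->.
  have awx : adj T w x by rewrite /adj wx setUC.
  have [wp|wp] := boolP (w \in p); last first.
    exists w, x, (y :: p); split=> /=; last by rewrite sp.
      by move: up => /= ->; rewrite !inE !negb_or wx wy wp.
    by move: pp => /= ->; rewrite awx.
  (* A prolongation that returns to the path closes a cycle through [x], [y] and [w], hence of
     length at least three. *)
  case/splitPr: wp up pp {sp} => p1 p2 up pp.
  case: (negP (aT (rcons [:: x, y & p1] w) _ _)).
  - move: up; rewrite -cat_rcons -!cat_cons cat_uniq => /andP[].
    by rewrite !rcons_cons.
  - by rewrite size_rcons.
  rewrite /= rcons_path last_rcons awx andbT.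
  by move: pp; rewrite -cat_rcons /= cat_path => /and3P[-> -> _].
have [x [y [p [up _ sp]]]] := long #|V|.
have := max_card (mem [:: x, y & p]); rewrite (card_uniqP up) /= sp.
by rewrite ltnNge leqW.
Qed.

End CollapseOfStt.

(** * Runs of the algorithm *)

Section CollapseOfRun.
Import mathcomp.boot.fintype mathcomp.boot.finset.
Variable V : finType.
Implicit Types (K T kn L S z c F : {set {set V}}) (s t e f : {set V}).
Implicit Types l : seq ({set V} * {set V}).

(* A run lists, latest first, the steps of the algorithm that discover a new edge. *)
Definition known T l := T :|: [set e in unzip1 l].
Definition used l : {set {set V}} := [set f in unzip2 l].

(** Requiring [e] to be unknown and all other edges of [f] known makes the incidence matrix of the
    run triangular. *)
Fixpoint is_run K T l : Prop :=
  if l is (e, f) :: l' then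
    [/\ is_run K T l', f \in triangles K, e \subset f /\ #|e| = 2,
        e \notin known T l' &
        forall e', e' \subset f -> #|e'| = 2 -> e' != e -> e' \in known T l']
  else True.

Lemma known_cons T e f l : known T ((e, f) :: l) = e |: known T l.
Proof. by apply/setP => x; rewrite !inE orbCA. Qed.

Lemma used_cons e f l : used ((e, f) :: l) = f |: used l.
Proof. by apply/setP => x; rewrite !inE. Qed.

Lemma stt_run K T st :
  clos_refl_trans _ (@stt_step V) (stt_init K T) st ->
  st.2 \subset triangles K /\ exists l, is_run K T l /\ st.1 = known T l.
Proof.
move=> cl; have := clos_rt_rtn1 _ _ _ _ cl.
elim=> {cl} [|st' st'' step _ [LK [l [rl kE]]]].
  by split=> //; exists [::]; split=> //=; apply/setP => x; rewrite !inE in_nil orbF.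
case: step LK kE => kn L f e1 e2 e fL s1 s2 s3 c1 c2 c3 n12 n31 n32 k1 k2 /= LK kE.
split; first by apply: subset_trans LK; apply: subsetDl.
(* A step may assign an edge that already has a value; it consumes a triangle without enlarging [kn]
   and is dropped from the run. *)
have [ekn|ekn] := boolP (e \in kn).
  by exists l; split=> //; rewrite -kE; apply/setUidPr; rewrite sub1set.
exists ((e, f) :: l); rewrite known_cons kE /=; split=> //.
split=> //; rewrite -?kE //; first exact: (subsetP LK).
have cf : #|f| = 3 by move: (subsetP LK f fL); rewrite inE => /andP[_ /eqP].
move=> e' s4 c4 /negPf ne.
have := triangle_edges cf s1 s2 s3 s4 c1 c2 c3 c4 n12 n31 n32.
by rewrite ne /= => /orP[]/eqP->.
Qed.

(** Termination is a statement about stuck states, so one has to be reached first; this happens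
    because every step shortens the list. *)
Lemma stt_complete_run K T : stt_terminates K T ->
  exists l, is_run K T l /\ edges K \subset known T l.
Proof.
move=> term.
suff [st [cl stuck]] : exists st, clos_refl_trans _ (@stt_step V) (stt_init K T) st /\
    forall st', ~ stt_step st st'.
  have [_ [l [rl kE]]] := stt_run cl.
  by exists l; split=> //; rewrite -kE; apply: term.
have: clos_refl_trans _ (@stt_step V) (stt_init K T) (stt_init K T) by apply: rt_refl.
move: {2}(stt_init K T) => st; move: {2}#|st.2| (leqnn #|st.2|) => n.
elim: n st => [|n IH] st cn cl; case: (pselect (exists st', stt_step st st')) => [[st' step]|no].
- case: step cn cl => kn L f e1 e2 e fL; rewrite leqn0 cards_eq0 =>
    s1 s2 s3 c1 c2 c3 n12 n31 n32 k1 k2 /eqP /= L0.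
  by move: fL; rewrite L0 inE.
- by exists st; split=> // st' step; apply: no; exists st'.
- apply: (IH st'); last by apply: rt_trans cl _; apply: rt_step.
  case: step cn {cl} => kn L f e1 e2 e fL /= *.
  by rewrite -ltnS; apply: leq_trans (_ : #|L| <= _) => //; rewrite [X in _ < X](cardsD1 f) fL.
- by exists st; split=> // st' step; apply: no; exists st'.
Qed.

Lemma used_edges K T l g e : is_run K T l -> g \in used l -> e \subset g -> #|e| = 2 ->
  e \in known T l.
Proof.
elim: l => [|[a f] l IH] /=; first by rewrite inE.
move=> [rl fK [af ca] akn H]; rewrite used_cons known_cons !in_setU1 => /orP[/eqP->|gl] eg ce.
  by have [//|ne] := eqVneq e a; apply: H.
by rewrite (IH rl gl eg ce) orbT.
Qed.

Lemma used_triangles K T l : is_run K T l -> used l \subset triangles K.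
Proof.
elim: l => [|[a f] l IH] /=; first by move=> _; apply/subsetP => x; rewrite inE.
move=> [rl fK _ _ _]; rewrite used_cons; apply/subsetP => x.
by rewrite in_setU1 => /orP[/eqP->//|]; apply/subsetP/IH.
Qed.

(** The edge found last lies on no earlier used triangle, so a cycle cannot contain the last
    triangle; the induction then peels off the run. *)
Lemma used_no_cycle K T l z : is_run K T l -> z \subset used l -> two_cycle z -> z = set0.
Proof.
elim: l => [|[e f] l IH] /=.
  by move=> _ /subsetP zu _; apply/setP => x; rewrite inE; apply/negP => /zu; rewrite inE.
move=> [rl fK [ef ce] ekn H]; rewrite used_cons => /subsetP zu zc.
have nef g : g \in used l -> e \subset g = false.
  by move=> gl; apply: contraNF ekn => eg; apply: (used_edges rl gl eg ce).
have fz : f \notin z.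
  apply/negP => fz; move: (zc e ce); rewrite (bd_setD1 _ fz) ef /bd big1 //.
  move=> g; rewrite !inE => /andP[gf gz]; apply: nef.
  by move: (zu g gz); rewrite in_setU1 (negPf gf).
apply: IH => //; apply/subsetP => g gz; move: (zu g gz); rewrite in_setU1.
by case: eqP => [gf|//]; move: fz; rewrite -gf gz.
Qed.

(** Elimination along the run: if [c] contains the edge found last, adding the boundary of its
    triangle removes it. What remains in the end is a cycle inside the tree, hence zero. *)
Lemma known_cycle_bounds K T l c : (forall e, e \in T -> #|e| = 2) -> acyclic T ->
  is_run K T l -> c \subset known T l -> (forall v, bd c [set v] = false) ->
  exists2 z : {set {set V}}, z \subset used l & forall e, #|e| = 2 -> bd z e = (e \in c).
Proof.
move=> cT aT; elim: l c => [|[e f] l IH] c /=.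
  move=> _ /subsetP cTT cc; exists set0; first exact: sub0set.
  move=> e ce; rewrite bd0; apply/esym/negbTE/negP => ec.
  have cT' : c \subset T by apply/subsetP => x /cTT; rewrite !inE in_nil orbF.
  (* At a leaf of a nonempty [c] the boundary of [c] would be 1. *)
  have [|x xc|d ud sd|v [g [gc vg gl]]] := @acyclic_leaf _ c.
  - by apply/set0Pn; exists e.
  - by apply/cT/(subsetP cT').
  - apply: contra (aT d ud sd); apply: sub_cycle; exact: adj_sub.
  move: (cc v); rewrite (bd_setD1 _ gc) sub1set vg /bd big1 // => h.
  by rewrite !inE sub1set => /andP[hg hc]; apply: contraNF hg => vh; rewrite (gl h).
move=> [rl fK [ef ce] ekn H]; rewrite known_cons used_cons => /subsetP ckn cc.
have [ec|ec] := boolP (e \in c); last first.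
  have [|z zu zE] := IH c rl _ cc; last first.
    by exists z => //; apply: subset_trans zu _; apply: subsetUr.
  apply/subsetP => g gc; move: (ckn g gc); rewrite in_setU1.
  by case: eqP => [gf|//]; move: ec; rewrite -gf gc.
have cf : #|f| = 3 by move: fK; rewrite inE => /andP[_ /eqP].
pose d := [set x : {set V} | (#|x| == 2) && (x \subset f)].
have [|v|z zu zE] := IH [set x | (x \in c) (+) (x \in d)] rl.
- apply/subsetP => x; rewrite !inE.
  have [->|xe] := eqVneq x e; first by rewrite ec ef ce eqxx.
  have [xc|xc] := boolP (x \in c).
    by move: (ckn x xc); rewrite in_setU1 (negPf xe) /= !inE.
  by rewrite /= => /andP[/eqP cx xf]; move: (H x xf cx xe); rewrite !inE.
- by rewrite bd_symdiff cc [bd d _](bd_faces (k := 1)) ?cards1.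
have fz : f \notin z.
  apply/negP => /(subsetP zu) fl.
  by case/negP: ekn; apply: (used_edges rl fl ef ce).
exists (f |: z); first by apply: setUS.
by move=> x cx; rewrite bd_setU1 // zE // !inE cx eqxx /=; case: (x \subset f); case: (x \in c).
Qed.

Definition skeleton l T : {set {set V}} :=
  [set s : {set V} | #|s| == 1] :|: known T l :|: used l.

Lemma in_skeleton l T x :
  (x \in skeleton l T) = [|| #|x| == 1, x \in known T l | x \in used l].
Proof. by rewrite in_setU [X in X || _]in_setU in_set orbA. Qed.

Lemma in_skeleton_cons e f l T x : (x \in skeleton ((e, f) :: l) T) =
  [|| #|x| == 1, x == e, x \in known T l, x == f | x \in used l].
Proof. by rewrite in_skeleton known_cons used_cons !in_setU1 -!orbA. Qed.

(** The latest edge [e] is free: any other used triangle through it would have made it known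
    earlier. *)
Lemma run_collapse K T l : (forall e, e \in T -> #|e| = 2) -> is_run K T l ->
  clos_refl_trans _ (@elementary_collapse V) (skeleton l T) (skeleton [::] T).
Proof.
move=> cT; elim: l => [|[e f] l IH] /=; first by move=> _; apply: rt_refl.
move=> [rl fK [ef ce] ekn H]; apply: rt_trans (IH rl); apply: rt_step.
have cf : #|f| = 3 by move: fK; rewrite inE => /andP[_ /eqP].
have ckn x : x \in known T l -> #|x| = 2.
  elim: l {IH ekn H} rl => [|[a g] l IH] /=; first by rewrite !inE in_nil orbF => _ /cT.
  by move=> [rl _ [_ ca] _ _]; rewrite known_cons in_setU1 => /orP[/eqP->|/(IH rl)].
have cu x : x \in used l -> #|x| = 3.
  by move=> /(subsetP (used_triangles rl)); rewrite inE => /andP[_ /eqP].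
have fu : f \notin used l.
  by apply: contra ekn => fu; apply: (used_edges rl fu ef ce).
exists e, f; split.
- by rewrite !in_skeleton_cons !eqxx !orbT.
- by rewrite properEcard ef ce cf.
- by rewrite ce cf.
- move=> r; rewrite in_skeleton_cons => rK er.
  have cr : 2 < #|r| by rewrite -ce; apply: proper_card.
  move: rK => /orP[/eqP c1|/orP[/eqP rE|/orP[/ckn c2|/orP[/eqP//|ru]]]].
  + by rewrite c1 in cr.
  + by rewrite rE ce in cr.
  + by rewrite c2 in cr.
  + by case/negP: ekn; apply: (used_edges rl ru _ ce); apply: proper_sub.
- apply/setP => x; rewrite !in_setD1 in_skeleton_cons in_skeleton.
  have [->|xf] /= := eqVneq x f.
    by rewrite cf (negPf fu) orbF; apply/negP => /ckn; rewrite cf.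
  have [->|//] := eqVneq x e.
  by rewrite ce (negPf ekn); apply/negP => /cu; rewrite ce.
Qed.

Definition forest_complex (W : {set V}) T : {set {set V}} :=
  [set [set v] | v in W] :|: T.

(** A leaf is collapsed together with its edge. Connectedness is phrased through vertex sets closed
    under adjacency, which passes to [W :\ v] without rerouting paths. *)
Lemma tree_collapse (W : {set V}) T : W != set0 ->
  (forall e, e \in T -> #|e| = 2) -> (forall e, e \in T -> e \subset W) -> acyclic T ->
  (forall X : {set V}, X \subset W -> X != set0 ->
    (forall u v, u \in X -> adj T u v -> v \in X) -> X = W) ->
  exists v, clos_refl_trans _ (@elementary_collapse V) (forest_complex W T) [set [set v]].
Proof.
move: {2}#|T| (leqnn #|T|) => n; elim: n T W => [|n IH] T W.
  rewrite leqn0 cards_eq0 => /eqP-> /set0Pn[v vW] _ _ _ con; exists v.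
  have -> : W = [set v].
    apply/esym/con; rewrite ?sub1set //; first by apply/set0Pn; exists v; rewrite set11.
    by move=> a b _; rewrite /adj in_set0 andbF.
  by rewrite /forest_complex setU0 imset_set1; apply: rt_refl.
move=> cTn W0 cT TW aT con.
have [T0|T0] := eqVneq T set0; first by apply: IH => //; rewrite T0 cards0.
have [v [e [eT ve el]]] := acyclic_leaf T0 cT aT.
have ce := cT _ eT.
have /cards1P[w ew] : #|e :\ v| == 1.
  by move: (cardsD1 v e); rewrite ve ce add1n => -[<-].
have eE : e = [set v; w] by rewrite -ew setD1K.
have wv : w != v by move: (set11 w); rewrite -ew !inE => /andP[].
have /subsetP eW := TW _ eT.
have vW : v \in W by apply: eW.
have wW : w \in W by apply: eW; rewrite eE !inE eqxx orbT.
have TD x : x \in T :\ e -> v \notin x.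
  by rewrite !inE => /andP[xe xT]; apply: contra xe => vx; rewrite (el x).
have [||||| |u cl] := IH (T :\ e) (W :\ v).
- by rewrite -ltnS; apply: leq_trans cTn; rewrite [X in _ < X](cardsD1 e) eT.
- by apply/set0Pn; exists w; rewrite !inE wv.
- by move=> x; rewrite !inE => /andP[_ /cT].
- move=> x xT; rewrite subsetD1 TD // andbT; apply: TW.
  by move: xT; rewrite !inE => /andP[].
- move=> d ud sd; apply: contra (aT d ud sd); apply: sub_cycle; apply: adj_sub.
  exact: subsetDl.
- move=> X; rewrite subsetD1 => /andP[XW vX] X0 Xcl.
  (* If [w] is in [X], then [v |: X] is closed for [T]. Otherwise [X] itself is closed for [T], so
     it equals [W] and contains [v], which is excluded. *)
  have [wX|wX] := boolP (w \in X).
    rewrite -(con (v |: X)) ?setU1K //.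
    + by rewrite subUset sub1set vW.
    + by apply/set0Pn; exists v; rewrite !inE eqxx.
    move=> a b aX /andP[ab abT]; rewrite in_setU1.
    have [abE|nab] := eqVneq [set a; b] e.
      have : b \in e by rewrite -abE !inE eqxx orbT.
      by rewrite eE !inE => /orP[->//|/eqP->]; rewrite wX orbT.
    have av : a != v.
      by apply: contraNneq nab => aE; apply/eqP/el; rewrite // aE !inE eqxx.
    have aX' : a \in X by move: aX; rewrite in_setU1 (negPf av).
    by rewrite (Xcl a b) ?orbT // /adj ab !inE nab.
  exfalso; move/negP: (vX); apply; rewrite (con X) // => a b aX /andP[ab abT].
  apply: (Xcl a) => //; rewrite /adj ab !inE abT andbT.
  apply/eqP => abE; have : a \in e by rewrite -abE !inE eqxx.
  rewrite eE !inE => /orP[]/eqP aE; last by rewrite -aE aX in wX.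
  by move/negP: vX; rewrite -aE.
exists u; apply: rt_trans cl; apply: rt_step; exists [set v], e; split.
- by rewrite !in_setU eT orbT imset_f.
- by rewrite properEcard sub1set ve cards1 ce.
- by rewrite ce cards1.
- move=> r; rewrite in_setU => /orP[/imsetP[x _ ->]|rT] pr.
    by move: (proper_card pr); rewrite !cards1.
  by apply: el => //; rewrite -sub1set proper_sub.
apply/setP => x; rewrite !in_setD1 !in_setU !in_setD1.
have [->|xe] /= := eqVneq x e.
  rewrite orbF; apply/negbTE/negP => /imsetP[y _ E]; move: ce; by rewrite E cards1.
have [->|xv] /= := eqVneq x [set v].
  apply/negbTE/negP => /orP[/imsetP[y + /set1_inj E]|/cT]; last by rewrite cards1.
  by rewrite -E !inE eqxx.
congr (_ || _); apply/imsetP/imsetP => -[y]; rewrite ?inE.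
  by move=> /andP[_ yW] ->; exists y.
move=> yW E; exists y => //; rewrite !inE yW andbT; apply: contraNneq xv => <-; by rewrite E.
Qed.

End CollapseOfRun.

(** * Collapsing the tetrahedra *)

Section CollapseTetrahedra.
Import mathcomp.boot.fintype mathcomp.boot.finset.
Variable V : finType.
Implicit Types (K T kn L S z c F : {set {set V}}) (s t e f : {set V}).

Lemma free_triangle K F : no_three_cycle K -> pseudomanifold K ->
  (forall z, z \subset F -> two_cycle z -> z = set0) -> tetrahedra K != set0 ->
  exists f t, [/\ f \notin F, #|f| = 3, t \in tetrahedra K, f \subset t &
    forall t', t' \in tetrahedra K -> f \subset t' -> t' = t].
Proof.
move=> no3 pm Fc S0; set S := tetrahedra K in S0 *.
pose z := [set f : {set V} | (#|f| == 3) && bd S f].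
have [f0 cf0 bf0] := no3 S (subxx _) S0.
have [zF|/subsetPn[f]] := boolP (z \subset F).
  have z0 : z = set0.
    apply: Fc => // e ce; apply: (bd_bd (k := 2)) => // t.
    by rewrite inE => /andP[_ /eqP].
  by move/setP: z0 => /(_ f0); rewrite !inE cf0 bf0.
(* Coefficient 1 means an odd number of tetrahedra on [f]; being at most two, there is exactly
   one. *)
rewrite inE => /andP[/eqP cf]; rewrite /bd big_addb_odd => odf fF.
have := pm f cf; move: odf; set A := [set t in S | f \subset t].
case cA : #|A| => [|[|[|n]]] // _ _.
have /cards1P[t At] : #|A| == 1 by rewrite cA.
have tA x : (x \in S) && (f \subset x) = (x == t).
  by move/setP: At => /(_ x); rewrite in_set1 in_set.
have /andP[tS ft] : (t \in S) && (f \subset t) by rewrite tA.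
exists f, t; split=> // t' t'S ft'; apply/eqP; by rewrite -tA t'S.
Qed.

Lemma no_tetrahedra K F : (forall s, s \in K -> #|s| <= 4) ->
  F \subset triangles K -> bounding K -> tetrahedra K = set0 ->
  (forall f, f \in triangles K ->
    exists2 z : {set {set V}}, z \subset F & forall e, #|e| = 2 -> bd z e = (e \subset f)) ->
  [set s in K | #|s| <= 2] :|: F = K.
Proof.
move=> K4 FK bK S0 Fb.
apply/setP => s; rewrite !inE; have [sK|sK] := boolP (s \in K); last first.
  by apply: contraNF sK => /(subsetP FK); rewrite inE => /andP[].
rewrite /=; have := K4 s sK; rewrite leq_eqVlt => /orP[c4|].
  by move/setP: S0 => /(_ s); rewrite !inE sK c4.
rewrite ltnS leq_eqVlt ltnS => /orP[c3|-> //].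
have sT : s \in triangles K by rewrite inE sK.
have [sF|sF] := boolP (s \in F); first by rewrite orbT.
have [z zF zE] := Fb s sT.
have sz : s \notin z by apply: contra sF => /(subsetP zF).
(* Here [z] lies in [F] and has the same boundary as [s], so [s |: z] is a 2-cycle; with no
   tetrahedra left it can bound only if empty. *)
have [||S + SE] := bK (s |: z).
- by rewrite subUset sub1set sT (subset_trans zF).
- by move=> e ce; rewrite bd_setU1 // zE // addbb.
rewrite S0 subset0 => /eqP SE0; move: (SE s (eqP c3)).
by rewrite SE0 bd0 in_setU1 eqxx.
Qed.

Lemma collapse_tetrahedra K F :
  is_simplicial_complex K -> (forall s, s \in K -> #|s| <= 4) ->
  F \subset triangles K -> bounding K -> no_three_cycle K -> pseudomanifold K ->
  (forall z, z \subset F -> two_cycle z -> z = set0) ->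
  (forall f, f \in triangles K ->
    exists2 z : {set {set V}}, z \subset F & forall e, #|e| = 2 -> bd z e = (e \subset f)) ->
  clos_refl_trans _ (@elementary_collapse V) K ([set s in K | #|s| <= 2] :|: F).
Proof.
move: {2}#|tetrahedra K| (leqnn #|tetrahedra K|) => n.
elim: n K => [|n IH] K cn cK K4 FK bK no3 pm Fc Fb;
  have [S0|S0] := eqVneq (tetrahedra K) set0;
  try by rewrite no_tetrahedra //; apply: rt_refl.
  by move: cn; rewrite leqn0 cards_eq0 (negPf S0).
have [f [t [fF cf tS ft fr]]] := free_triangle no3 pm Fc S0.
have [tK ct] : t \in K /\ #|t| = 4 by move: tS; rewrite inE => /andP[-> /eqP].
have fK : f \in K by apply: (cK.2 t) => //; rewrite cf.
have pft : f \proper t by rewrite properEcard ft cf ct.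
set K' := K :\ f :\ t.
have col : elementary_collapse K K'.
  exists f, t; split; rewrite ?ct ?cf // => r rK fr'; apply: fr; last exact: proper_sub.
  rewrite inE rK eqn_leq K4 //=; move: (proper_card fr'); by rewrite cf.
have K'K : K' \subset K by apply: elementary_collapse_sub.
have tetK' : tetrahedra K' = tetrahedra K :\ t.
  apply/setP => x; rewrite !inE; case: eqP => //= _; case: eqP => //= ->.
  by rewrite cf andbF.
have sub : tetrahedra K' \subset tetrahedra K by rewrite tetK' subsetDl.
have inK' x : x != f -> #|x| <= 3 -> x \in K -> x \in K'.
  move=> xf cx xK; rewrite !inE xf xK !andbT; apply: contraTneq cx => ->; by rewrite ct.
have -> : [set s in K | #|s| <= 2] = [set s in K' | #|s| <= 2].
  apply/setP => x; rewrite !inE; have [c2|] := boolP (#|x| <= 2); rewrite ?andbF ?andbT //.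
  case: (x \in K); rewrite ?andbF ?andbT //.
  by apply/esym/andP; split; apply: contraTneq c2 => ->; rewrite ?ct ?cf.
apply: rt_trans (rt_step _ _ _ _ col) _; apply: IH => //.
- rewrite -ltnS; apply: leq_trans cn; rewrite tetK' [X in _ < X](cardsD1 t) tS; exact: leqnn.
- exact: elementary_collapse_complex col.
- by move=> s /(subsetP K'K)/K4.
- apply/subsetP => x xF; move: (subsetP FK x xF); rewrite !inE => /andP[xK /eqP cx].
  rewrite xK cx eqxx !andbT; apply/andP; split; last by apply: contraNneq fF => <-.
  by apply/eqP => E; rewrite E ct in cx.
(* The filling [S] found in [K] avoids [t]: only [t] contains [f], so otherwise [f] would lie in
   [z], but [f] is no longer in [K']. *)
- move=> z zK' zc; have [|S SK SE] := bK z _ zc.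
    by apply: (subset_trans zK'); apply/subsetP => x; rewrite !inE => /andP[/and3P[_ _ ->] ->].
  exists S => //; rewrite tetK' subsetD1 SK /=; apply/negP => tS'.
  have := SE f cf; rewrite (bd_setD1 _ tS') ft /bd big1.
    move=> /esym fz; move: (subsetP zK' _ fz).
    by rewrite !inE eqxx !andbF.
  move=> x; rewrite !inE => /andP[xt xS]; apply: contraNF xt => fx.
  by rewrite (fr x) // (subsetP SK).
- by move=> S SK; apply: no3; apply: subset_trans sub.
- move=> g cg; apply: leq_trans (pm g cg); apply/subset_leq_card/subsetP => x.
  by rewrite 2!in_set => /andP[/(subsetP sub) xt gx]; rewrite gx andbT.
- by move=> g; rewrite inE => /andP[/(subsetP K'K) gK cg]; apply: Fb; rewrite inE gK.
Qed.

Lemma stt_collapsible K T : is_simplicial_complex K -> all_vertices K ->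
  (forall s, s \in K -> #|s| <= 4) -> (exists v : V, true) ->
  bounding K -> no_three_cycle K -> pseudomanifold K ->
  spanning_tree K T -> stt_terminates K T -> collapsible K.
Proof.
move=> cK vK K4 [v0 _] bK no3 pm [TE Tc Ta] /stt_complete_run[l [rl ekn]].
have cT e : e \in T -> #|e| = 2 by move=> /(subsetP TE); rewrite inE => /andP[_ /eqP].
have [v cl] : exists v, clos_refl_trans _ (@elementary_collapse V) (skeleton [::] T) [set [set v]].
  have [|||||v cl] := @tree_collapse V [set: V] T.
  - by apply/set0Pn; exists v0; rewrite in_setT.
  - exact: cT.
  - by move=> e _; apply: subsetT.
  - exact: Ta.
  - move=> X _ /set0Pn[x xX] Xcl; apply/setP => y; rewrite inE.
    have /connectP[p + ->] := Tc x y.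
    elim: p x xX => //= z p IH x xX /andP[xz]; apply: IH; exact: Xcl xz.
  exists v; suff -> : skeleton [::] T = forest_complex [set: V] T by [].
  apply/setP => x; rewrite in_skeleton !inE !in_nil !orbF; congr (_ || _).
  by apply/cards1P/imsetP => -[y]; [move=> ->; exists y|move=> _ ->; exists y].
exists v; apply: rt_trans cl; apply: rt_trans (run_collapse cT rl).
(* Vertices and edges agree with those of [K] because the run is complete; the used triangles play
   the role of [F]. *)
have -> : skeleton l T = [set s in K | #|s| <= 2] :|: used l.
  have knE : known T l = edges K.
    apply/eqP; rewrite eqEsubset ekn andbT.
    elim: l {ekn} rl => [_|[e f] l IH /= [rl fK [ef ce] _ _]].
      by apply/subsetP => x; rewrite !inE in_nil orbF => /(subsetP TE); rewrite inE.
    rewrite known_cons subUset IH // andbT sub1set inE ce eqxx andbT.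
    by move: fK; rewrite inE => /andP[fK _]; apply: (cK.2 f) => //; rewrite ce.
  apply/setP => x; rewrite in_skeleton knE !inE orbA; congr (_ || _).
  have [xK|xK] /= := boolP (x \in K); last first.
    rewrite orbF; apply: contraNF xK => /cards1P[y ->]; exact: vK.
  by have := cK.1 x xK; case: #|x| => [|[|[|n]]].
apply: collapse_tetrahedra => //.
- exact: used_triangles rl.
- by move=> z; apply: used_no_cycle rl.
move=> f; rewrite inE => /andP[fK /eqP cf].
have [||z zu zE] := @known_cycle_bounds _ K T l
    [set x : {set V} | (#|x| == 2) && (x \subset f)] cT Ta rl.
- apply: subset_trans ekn; apply/subsetP => x; rewrite !inE => /andP[/eqP cx xf].
  by rewrite cx eqxx andbT; apply: (cK.2 f) => //; rewrite cx.
- by move=> v'; apply: (bd_faces (k := 1)); rewrite ?cards1.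
by exists z => // e ce; rewrite zE // inE ce.
Qed.

End CollapseTetrahedra.

(** * Sperner's lemma on a cubical grid *)

Section Sperner.

Definition full1 a b := perm_eq [:: a; b] (iota 0 2).
Definition full2 a b c := perm_eq [:: a; b; c] (iota 0 3).
Definition full3 a b c d := perm_eq [:: a; b; c; d] (iota 0 4).

(** Door counting, here and in the next two dimensions: a simplex with all labels has one facet
    carrying exactly the labels below the top one; any other simplex has none or two. *)
Lemma full1_doors a b : a < 2 -> b < 2 -> full1 a b = (b == 0) (+) (a == 0).
Proof. by case: a => [|[|]] //; case: b => [|[|]]. Qed.

Lemma full2_doors a b c : a < 3 -> b < 3 -> c < 3 ->
  full2 a b c = full1 b c (+) full1 a c (+) full1 a b.
Proof.
by case: a => [|[|[|]]] //; case: b => [|[|[|]]] //; case: c => [|[|[|]]].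
Qed.

Lemma full3_doors a b c d : a < 4 -> b < 4 -> c < 4 -> d < 4 ->
  full3 a b c d = full2 b c d (+) full2 a c d (+) full2 a b d (+) full2 a b c.
Proof.
by case: a => [|[|[|[|]]]] //; case: b => [|[|[|[|]]]] //;
   case: c => [|[|[|[|]]]] //; case: d => [|[|[|[|]]]].
Qed.

Lemma telescope_addb (g : nat -> bool) n :
  \big[addb/false]_(i < n) (g i.+1 (+) g i) = g n (+) g 0.
Proof.
elim: n => [|n IH]; first by rewrite big_ord0 addbb.
by rewrite big_ord_recr /= IH; case: (g n); case: (g 0); case: (g n.+1).
Qed.

Lemma parity1 (lam : nat -> nat) n :
  (forall i, i <= n -> lam i < 2) -> lam 0 = 0 -> lam n <> 0 ->
  \big[addb/false]_(i < n) full1 (lam i) (lam i.+1).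
Proof.
move=> l2 l0 ln; under eq_bigr => i _ do rewrite full1_doors ?l2 ?(ltnW (ltn_ord i)) //.
by rewrite (telescope_addb (fun i => lam i == 0)) l0; case: (lam n) ln.
Qed.

Definition cell2 (lam : nat -> nat -> nat) i j :=
  full2 (lam i j) (lam i.+1 j) (lam i.+1 j.+1) (+)
  full2 (lam i j) (lam i j.+1) (lam i.+1 j.+1).

(** The diagonal is shared and cancels; the four sides are grouped in opposite pairs so that the sum
    over the grid telescopes. *)
Lemma cell2_doors (p q r s : nat) : p < 3 -> q < 3 -> r < 3 -> s < 3 ->
  full2 p q s (+) full2 p r s =
  (full1 q s (+) full1 p r) (+) (full1 r s (+) full1 p q).
Proof.
move=> ? ? ? ?; rewrite !full2_doors //.
by case: (full1 q s); case: (full1 p s); case: (full1 p q); case: (full1 r s);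
   case: (full1 p r).
Qed.

Lemma full1_false a b k : k < 2 -> a != k -> b != k -> full1 a b = false.
Proof.
move=> k2 ak bk; apply/negP => /perm_mem/(_ k); rewrite !inE.
by rewrite ![k == _]eq_sym in ak bk *; rewrite (negPf ak) (negPf bk); case: k k2 {ak bk} => [|[|]].
Qed.

Lemma full2_false a b c k : k < 3 -> a != k -> b != k -> c != k -> full2 a b c = false.
Proof.
move=> k2 ak bk ck; apply/negP => /perm_mem/(_ k); rewrite !inE ![k == _]eq_sym.
by rewrite (negPf ak) (negPf bk) (negPf ck); case: k k2 {ak bk ck} => [|[|[|]]].
Qed.

(** After telescoping only the sides of the large square remain. Three of them miss the label 0 or
    1; the side [j = 0] is the one-dimensional case. *)
Lemma parity2 (lam : nat -> nat -> nat) n :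
  (forall i j, i <= n -> j <= n -> lam i j < 3) ->
  (forall j, j <= n -> lam 0 j <= 0) -> (forall j, j <= n -> lam n j <> 0) ->
  (forall i, i <= n -> lam i 0 <= 1) -> (forall i, i <= n -> lam i n <> 1) ->
  \big[addb/false]_(i < n) \big[addb/false]_(j < n) cell2 lam i j.
Proof.
move=> l3 x0 xn y0 yn.
pose gx i j := full1 (lam i j) (lam i j.+1).
pose gy j i := full1 (lam i j) (lam i.+1 j).
transitivity (\big[addb/false]_(i < n) \big[addb/false]_(j < n)
    ((gx i.+1 j (+) gx i j) (+) (gy j.+1 i (+) gy j i))).
  by apply: eq_bigr => i _; apply: eq_bigr => j _;
     apply: cell2_doors; apply: l3; rewrite // ltnW.
under eq_bigr => i _ do rewrite big_split.
rewrite big_split /= exchange_big /=.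
under eq_bigr => j _ do rewrite (telescope_addb (gx^~ j)).
rewrite big1 => [|j _]; last first.
  rewrite /gx (@full1_false _ _ 0) ?(@full1_false _ _ 1) //.
  - by rewrite neq_ltn ltnS x0 // ltnW.
  - by rewrite neq_ltn ltnS x0.
  - by apply/eqP/xn; rewrite ltnW.
  - exact/eqP/xn.
under eq_bigr => i _ do rewrite (telescope_addb (gy^~ i)).
rewrite big_split /= big1 => [|i _]; last first.
  by rewrite /gy (@full1_false _ _ 1) //; apply/eqP/yn; rewrite // ltnW.
apply: (parity1 (lam := fun i => lam i 0)) => [i le||]; first exact: y0.
  by apply/eqP; rewrite -leqn0 x0.
exact: xn.
Qed.

(** The [d] and [e] stand for the six triangles through the main diagonal of the cube, each shared
    by two tetrahedra; the [a] and [b] are the outer triangles, regrouped by pairs of opposite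
    faces. *)
Lemma cancel_cube (a1 a2 a3 a4 a5 a6 b1 b2 b3 b4 b5 b6 d1 d2 d3 e1 e2 e3 : bool) :
  (a1 (+) d1 (+) e1 (+) b1) (+) (a2 (+) d1 (+) e2 (+) b2) (+)
  (a3 (+) d2 (+) e1 (+) b3) (+) (a4 (+) d2 (+) e3 (+) b4) (+)
  (a5 (+) d3 (+) e2 (+) b5) (+) (a6 (+) d3 (+) e3 (+) b6) =
  ((a1 (+) a3) (+) (b5 (+) b6)) (+) ((a2 (+) a5) (+) (b3 (+) b4)) (+)
  ((a4 (+) a6) (+) (b1 (+) b2)).
Proof.
have addbE a b : addb a b = xorb a b by case: a; case: b.
rewrite !addbE; btauto.
Qed.

(* The six tetrahedra of the Kuhn triangulation of a unit cube. *)
Definition cell3 (lam : nat -> nat -> nat -> nat) i j k :=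
  let o := lam i j k in let w := lam i.+1 j.+1 k.+1 in
  let x := lam i.+1 j k in let y := lam i j.+1 k in let z := lam i j k.+1 in
  let xy := lam i.+1 j.+1 k in let xz := lam i.+1 j k.+1 in let yz := lam i j.+1 k.+1 in
  full3 o x xy w (+) full3 o y xy w (+) full3 o x xz w (+)
  full3 o z xz w (+) full3 o y yz w (+) full3 o z yz w.

Lemma cell3_doors lam i j k :
  (forall a b c, a <= 1 -> b <= 1 -> c <= 1 -> lam (a + i) (b + j) (c + k) < 4) ->
  cell3 lam i j k =
  (cell2 (lam i.+1) j k (+) cell2 (lam i) j k) (+)
  (cell2 (fun i k => lam i j.+1 k) i k (+) cell2 (fun i k => lam i j k) i k) (+)
  (cell2 (fun i j => lam i j k.+1) i j (+) cell2 (fun i j => lam i j k) i j).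
Proof.
move=> l4; have l a b c := l4 (nat_of_bool a) (nat_of_bool b) (nat_of_bool c)
  (leq_b1 a) (leq_b1 b) (leq_b1 c).
rewrite /cell3 /cell2.
have := l false false false; have := l true false false; have := l false true false.
have := l false false true; have := l true true false; have := l true false true.
have := l false true true; have := l true true true; rewrite /= !add0n !add1n => *.
rewrite !full3_doors //; exact: cancel_cube.
Qed.

Lemma cell2_false lam i j k : k < 3 ->
  (forall a b, a <= 1 -> b <= 1 -> lam (a + i) (b + j) != k) -> cell2 lam i j = false.
Proof.
move=> k3 lk; have l a b := lk (nat_of_bool a) (nat_of_bool b) (leq_b1 a) (leq_b1 b).
have := l false false; have := l true false; have := l false true; have := l true true.
rewrite /cell2 /= !add0n !add1n => *.
by rewrite !(@full2_false _ _ _ k).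
Qed.

(** Same scheme one dimension up: five faces of the large cube miss a label among 0, 1, 2, and the
    face [k = 0] satisfies the conditions of [parity2]. *)
Lemma parity3 (lam : nat -> nat -> nat -> nat) n :
  (forall i j k, i <= n -> j <= n -> k <= n -> lam i j k < 4) ->
  (forall j k, j <= n -> k <= n -> lam 0 j k <= 0) ->
  (forall j k, j <= n -> k <= n -> lam n j k <> 0) ->
  (forall i k, i <= n -> k <= n -> lam i 0 k <= 1) ->
  (forall i k, i <= n -> k <= n -> lam i n k <> 1) ->
  (forall i j, i <= n -> j <= n -> lam i j 0 <= 2) ->
  (forall i j, i <= n -> j <= n -> lam i j n <> 2) ->
  \big[addb/false]_(i < n) \big[addb/false]_(j < n) \big[addb/false]_(k < n) cell3 lam i j k.
Proof.
move=> l4 x0 xn y0 yn z0 zn.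
have le1 a (i : 'I_n) : a <= 1 -> a + i <= n.
  by move=> a1; apply: leq_trans (leq_add a1 (leqnn i)) _; rewrite add1n.
have cE (i j k : 'I_n) := cell3_doors (fun a b c a1 b1 c1 =>
  l4 _ _ _ (le1 _ i a1) (le1 _ j b1) (le1 _ k c1)).
under eq_bigr => i _ do under eq_bigr => j _ do under eq_bigr => k _ do rewrite cE.
under eq_bigr => i _ do under eq_bigr => j _ do rewrite big_split big_split /=.
under eq_bigr => i _ do rewrite big_split big_split /=.
rewrite big_split big_split /=.
rewrite exchange_big /= big1 => [|j _]; last first.
  rewrite exchange_big /= big1 // => k _.
  rewrite (telescope_addb (fun i => cell2 (lam i) j k)).
  rewrite (@cell2_false _ _ _ 0) ?(@cell2_false _ _ _ 1) //.
  - by move=> a b a1 b1; rewrite neq_ltn ltnS x0 // le1.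
  - by move=> a b a1 b1; apply/eqP/xn; apply: le1.
rewrite big1 => [|i _]; last first.
  rewrite exchange_big /= big1 // => k _.
  rewrite (telescope_addb (fun j => cell2 (fun i k => lam i j k) i k)).
  rewrite (@cell2_false _ _ _ 1) ?(@cell2_false _ _ _ 2) //.
  - by move=> a b a1 b1; rewrite neq_ltn ltnS y0 // le1.
  - by move=> a b a1 b1; apply/eqP/yn; apply: le1.
rewrite /= (_ : \big[_/_]_(i < n) _ =
    \big[addb/false]_(i < n) \big[addb/false]_(j < n) cell2 (fun i j => lam i j 0) i j).
  by apply: parity2 => [i j *|j ?|j ?|i ?|i ?]; [exact: z0|exact: x0|exact: xn|exact: y0|exact: yn].
apply: eq_bigr => i _; apply: eq_bigr => j _.
rewrite (telescope_addb (fun k => cell2 (fun i j => lam i j k) i j)).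
rewrite (@cell2_false _ _ _ 2) //.
by move=> a b a1 b1; apply/eqP/zn; apply: le1.
Qed.

Lemma sperner3 (lam : nat -> nat -> nat -> nat) n :
  (forall i j k, i <= n -> j <= n -> k <= n -> lam i j k < 4) ->
  (forall j k, j <= n -> k <= n -> lam 0 j k <= 0) ->
  (forall j k, j <= n -> k <= n -> lam n j k <> 0) ->
  (forall i k, i <= n -> k <= n -> lam i 0 k <= 1) ->
  (forall i k, i <= n -> k <= n -> lam i n k <> 1) ->
  (forall i j, i <= n -> j <= n -> lam i j 0 <= 2) ->
  (forall i j, i <= n -> j <= n -> lam i j n <> 2) ->
  exists i j k, [/\ i < n, j < n, k < n & forall m, m < 4 ->
    exists a b c : bool, lam (a + i) (b + j) (c + k) = m].
Proof.
move=> l4 x0 xn y0 yn z0 zn; have := parity3 l4 x0 xn y0 yn z0 zn.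
have [/existsP[i /existsP[j /existsP[k cijk]]] _|no] :=
  boolP [exists i : 'I_n, exists j : 'I_n, exists k : 'I_n, cell3 lam i j k]; last first.
  rewrite big1 // => i _; rewrite big1 // => j _; rewrite big1 // => k _.
  apply: contraNF no => c; apply/existsP; exists i; apply/existsP; exists j.
  by apply/existsP; exists k.
exists i, j, k; split=> // m m4.
have mem x y z t : full3 x y z t -> [|| m == x, m == y, m == z | m == t].
  by move=> /perm_mem/(_ m); rewrite mem_iota m4 !inE.
have : [|| full3 (lam i j k) (lam i.+1 j k) (lam i.+1 j.+1 k) (lam i.+1 j.+1 k.+1),
  full3 (lam i j k) (lam i j.+1 k) (lam i.+1 j.+1 k) (lam i.+1 j.+1 k.+1),
  full3 (lam i j k) (lam i.+1 j k) (lam i.+1 j k.+1) (lam i.+1 j.+1 k.+1),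
  full3 (lam i j k) (lam i j k.+1) (lam i.+1 j k.+1) (lam i.+1 j.+1 k.+1),
  full3 (lam i j k) (lam i j.+1 k) (lam i j.+1 k.+1) (lam i.+1 j.+1 k.+1) |
  full3 (lam i j k) (lam i j k.+1) (lam i j.+1 k.+1) (lam i.+1 j.+1 k.+1)].
  by apply: contraTT cijk; rewrite !negb_or /cell3 =>
    /and5P[/negPf-> /negPf-> /negPf-> /negPf-> /andP[/negPf-> /negPf->]].
have sol a b c : (m == lam (nat_of_bool a + i) (nat_of_bool b + j) (nat_of_bool c + k)) ->
    exists a b c : bool, lam (a + i) (b + j) (c + k) = m.
  by move=> /eqP mE; exists a, b, c.
have s000 := sol false false false; have s100 := sol true false false.
have s010 := sol false true false; have s001 := sol false false true.
have s110 := sol true true false; have s101 := sol true false true.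
have s011 := sol false true true; have s111 := sol true true true.
rewrite /= !add0n !add1n in s000 s100 s010 s001 s110 s101 s011 s111.
by move=> /or4P[/mem|/mem|/mem|/or3P[]/mem] /or4P[].
Qed.

End Sperner.

(** * Maps of space that are the identity far away are surjective *)

Section NoEscape.
Import Order.TTheory GRing.Theory Num.Theory.
Import numFieldNormedType.Exports.
Local Open Scope ring_scope.
Local Open Scope classical_set_scope.
Variable R : realType.
Local Notation pt := 'rV[R]_3.
Local Notation coord := Defs.coord.
Implicit Types (x y : pt).

Lemma coord_le_norm n (x : 'rV[R]_n) i : `|x ord0 i| <= `|x|.
Proof.
rewrite -[leRHS]/(mx_norm x) mx_normrE.
exact: (le_bigmax_cond _ (fun ij : 'I_1 * 'I_n => `|x ij.1 ij.2|) (j := (ord0, i))).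
Qed.

Lemma norm_le_coord n (x : 'rV[R]_n) e :
  0 <= e -> (forall i, `|x ord0 i| <= e) -> `|x| <= e.
Proof.
move=> e0 xe; rewrite -[leLHS]/(mx_norm x) mx_normrE.
by apply: bigmax_le => // -[i j] _ /=; rewrite ord1.
Qed.

Lemma norm_lt_coord n (x : 'rV[R]_n) e :
  0 < e -> (forall i, `|x ord0 i| < e) -> `|x| < e.
Proof.
move=> e0 xe; rewrite -[ltLHS]/(mx_norm x) mx_normrE.
by apply: bigmax_lt => // -[i j] _ /=; rewrite ord1.
Qed.

Lemma ord3P (P : 'I_3 -> Prop) : P c0 -> P c1 -> P c2 -> forall i, P i.
Proof.
move=> P0 P1 P2 [[|[|[|//]]] H].
- by rewrite (_ : Ordinal H = c0) //; apply: val_inj.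
- by rewrite (_ : Ordinal H = c1) //; apply: val_inj.
- by rewrite (_ : Ordinal H = c2) //; apply: val_inj.
Qed.

Definition mkpt (a b c : R) : pt := \row_i [:: a; b; c]`_i.

Lemma mkpt0 a b c : coord (mkpt a b c) c0 = a. Proof. by rewrite /coord mxE. Qed.
Lemma mkpt1 a b c : coord (mkpt a b c) c1 = b. Proof. by rewrite /coord mxE. Qed.
Lemma mkpt2 a b c : coord (mkpt a b c) c2 = c. Proof. by rewrite /coord mxE. Qed.

(** Index of the first negative coordinate, or 3 if there is none: label [k] makes coordinate [k]
    negative, label 3 makes all of them nonnegative. *)
Definition label y : nat :=
  if coord y c0 < 0 then 0 else if coord y c1 < 0 then 1%N
  else if coord y c2 < 0 then 2%N else 3.

Lemma sperner_cube (G : pt -> pt) (A : R) (n : nat) : 0 < A -> (0 < n)%N ->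
  (forall x k, coord x k = - A -> coord (G x) k < 0) ->
  (forall x k, coord x k = A -> 0 < coord (G x) k) ->
  exists x, `|x| <= A /\ forall m, (m < 4)%N ->
    exists y, `|x - y| <= 2 * A / n%:R /\ label (G y) = m.
Proof.
move=> A0 n0 Glo Ghi.
have nR : 0 < n%:R :> R by rewrite ltr0n.
(* The grid points cut [[-A, A]] into [n] equal parts. The signs of [G] on the faces of the cube are
   exactly the boundary conditions of [sperner3]. *)
pose g (i : nat) : R := - A + 2 * A * i%:R / n%:R.
pose lam i j k := label (G (mkpt (g i) (g j) (g k))).
have g0 : g 0%N = - A by rewrite /g mulr0 mul0r addr0.
have gn : g n = A by rewrite /g -mulrA divff ?gt_eqF // mulr1; lra.
have lab4 y : (label y < 4)%N by rewrite /label; do !case: ifP.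
have [|||||||i [j [k [lti ltj ltk full]]]] := @sperner3 lam n.
- by move=> *; apply: lab4.
- by move=> j k _ _; rewrite /lam /label Glo // mkpt0 g0.
- move=> j k _ _; rewrite /lam /label ltNge ltW ?Ghi ?mkpt0 ?gn //.
  by do !case: ifP.
- move=> i k _ _; rewrite /lam /label (Glo _ c1) ?mkpt1 ?g0 //; by case: ifP.
- move=> i k _ _; rewrite /lam /label; case: ifP => // _.
  by rewrite ltNge ltW ?Ghi ?mkpt1 ?gn //; case: ifP.
- move=> i j _ _; rewrite /lam /label (Glo _ c2) ?mkpt2 ?g0 //; by do !case: ifP.
- move=> i j _ _; rewrite /lam /label; case: ifP => // _; case: ifP => // _.
  by rewrite ltNge ltW ?Ghi ?mkpt2 ?gn.
have gle i' : (i' < n)%N -> `|g i'| <= A.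
  move=> lt; rewrite ler_norml lerDl /g; apply/andP; split.
    by rewrite divr_ge0 // ?mulr_ge0 // ?ler0n // ltW.
  rewrite -lerBrDl opprK -mulrA -[leRHS]mulr1 -mulr2n -[A *+ 2]mulr_natl ler_pM2l ?mulr_gt0 //.
  by rewrite ler_pdivrMr // mul1r ler_nat ltnW.
have gd (a : bool) i' : `|g i' - g (a + i')%N| <= 2 * A / n%:R.
  rewrite /g opprD opprK addrACA addNr add0r -mulrBl -mulrBr natrD opprD addrCA subrr addr0.
  have d0 : 0 <= 2 * A / n%:R by rewrite divr_ge0 ?mulr_ge0 ?ltW.
  rewrite mulrAC mulrN normrN normrM [`|2 * A / _|]ger0_norm // ler_piMr //.
  by case: a; rewrite /= ?normr1 ?normr0.
exists (mkpt (g i) (g j) (g k)); split.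
  apply: norm_le_coord; first exact: ltW.
  by apply: ord3P; rewrite -/(coord _ _) ?mkpt0 ?mkpt1 ?mkpt2 gle.
move=> m /full[a [b [c E]]]; exists (mkpt (g (a + i)%N) (g (b + j)%N) (g (c + k)%N)).
split=> //; apply: norm_le_coord; first by rewrite divr_ge0 ?mulr_ge0 ?ltW.
by apply: ord3P; rewrite !mxE /= gd.
Qed.

(** The Poincaré-Miranda theorem in dimension three. The zero is a cluster point of fully labelled
    cells of vanishing mesh. *)
Lemma zero_in_cube (G : pt -> pt) (A : R) : 0 < A -> continuous G ->
  (forall x k, coord x k = - A -> coord (G x) k < 0) ->
  (forall x k, coord x k = A -> 0 < coord (G x) k) ->
  exists x, G x = 0.
Proof.
move=> A0 cG Glo Ghi.
have /choice[c cP] : forall n : nat, exists x, `|x| <= A /\ forall m, (m < 4)%N ->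
    exists y, `|x - y| <= 2 * A / n.+1%:R /\ label (G y) = m.
  by move=> n; apply: sperner_cube.
have cptA : compact [set x : pt | `|x| <= A].
  apply: bounded_closed_compact.
    exists A; split; first exact: num_real.
    by move=> M AM x /= xA; apply: le_trans xA (ltW AM).
  apply: (@closed_comp _ _ (fun x : pt => `|x|) [set r | r <= A]); last exact: closed_le.
  by move=> x _; apply: norm_continuous.
have [|p [_ clp]] := cptA (c @ \oo) _.
  by exists 0%N => // n _ /=; have [] := cP n.
exists p; apply: contrapT => Gp.
have near_label m (e : R) : (m < 4)%N -> 0 < e -> exists2 y, `|p - y| < e & label (G y) = m.
  move=> m4 e0.
  (* If $1/(n+1) < e/(4A)$, the mesh $2A/(n+1)$ is below $e/2$; the other half pays for the distance
     from [c n] to [p]. *)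
  have e4 : 0 < e / (4 * A) by rewrite divr_gt0 // mulr_gt0.
  have [||_ [[n /= ne <-] pc]] := clp [set c n | n in [set n | n.+1%:R^-1 < e / (4 * A)]]
      (ball p (e / 2)).
  - by apply: filterS (near_infty_natSinv_lt (PosNum e4)) => n ?; exists n.
  - by apply: nbhsx_ballx; rewrite divr_gt0.
  have [_ /(_ m m4)[y [cy ly]]] := cP n; exists y => //.
  move: pc; rewrite -ball_normE /= => pc.
  rewrite -(subrK (c n) p) -addrA; apply: le_lt_trans (ler_normD _ _) _.
  have : 2 * A / n.+1%:R < e / 2.
    rewrite [ltRHS](_ : _ = 2 * A * (e / (4 * A))); last by field; rewrite gt_eqF.
    by rewrite ltr_pM2l // mulr_gt0.
  by move=> h; rewrite [e]splitr; apply: ltrD => //; apply: le_lt_trans h.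
have /existsNP[k /eqP Gk] : ~ forall k, coord (G p) k = 0.
  by move=> G0; apply: Gp; apply/rowP => k; rewrite mxE; apply: G0.
have cGk : (fun x => coord (G x) k) @ p --> coord (G p) k.
  apply: (continuous_comp (f := G) (g := fun y : pt => y ord0 k)); first exact: cG.
  exact: coord_continuous.
(* A negative coordinate would persist near [p], against label 3; a positive one would persist too,
   against label [k]. *)
have [Gk0|Gk0] := ltP (coord (G p) k) 0.
  have : \forall x \near p, coord (G x) k < 0 by apply: cvgr_lt cGk _ Gk0.
  move=> /nbhs_ballP[e /= e0 eP]; have [//|y py ly] := near_label 3%N e _ e0.
  have := eP y; rewrite -ball_normE /= => /(_ py).
  move: ly; rewrite /label; case: ltP => // h0; case: ltP => // h1; case: ltP => // h2 _.
  by rewrite ltNge; move: k {Gk cGk Gk0 eP}; apply: ord3P; rewrite ?h0 ?h1 ?h2.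
have {}Gk0 : 0 < coord (G p) k by rewrite lt_neqAle eq_sym Gk.
have : \forall x \near p, 0 < coord (G x) k by apply: cvgr_gt cGk _ Gk0.
move=> /nbhs_ballP[e /= e0 eP].
have [|y py ly] := near_label k e _ e0; first by apply: ltn_trans (ltn_ord k) _.
have := eP y; rewrite -ball_normE /= => /(_ py); rewrite ltNge => /negP; apply.
move: ly; rewrite /label; move: k {Gk cGk Gk0 eP}; apply: ord3P => /=;
  by case: ltP => [/ltW|_] //; case: ltP => [/ltW|_] //; case: ltP => [/ltW|_].
Qed.

Lemma surjective_of_id_far (G : pt -> pt) (M : R) x0 : continuous G ->
  (forall x, M < `|x| -> G x = x) -> exists x, G x = x0.
Proof.
move=> cG far.
(* Beyond [M], so that [G] is the identity on the faces of the cube; beyond the norm of [x0], so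
   that subtracting [x0] keeps the signs there. *)
pose A := 1 + `|M| + `|x0|.
have MA : M < A by rewrite /A; have := ler_norm M; have := normr_ge0 x0; lra.
have A0 : 0 < A by rewrite /A; have := normr_ge0 M; have := normr_ge0 x0; lra.
have kA k : `|coord x0 k| < A.
  apply: le_lt_trans (coord_le_norm x0 k) _; rewrite /A; have := normr_ge0 M; lra.
have [||||x] := @zero_in_cube (fun x => G x - x0) A => //.
- move=> x; apply: (@continuousB _ _ _ G (fun=> x0)); [exact: cG|exact: cst_continuous].
- move=> x k xk; rewrite far.
    rewrite /coord !mxE -![_ ord0 k]/(coord _ k) xk; have := kA k; rewrite ltr_norml; lra.
  apply: (lt_le_trans MA); apply: le_trans (coord_le_norm x k).
  by rewrite -/(coord _ _) xk normrN ler_norm.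
- move=> x k xk; rewrite far.
    rewrite /coord !mxE -![_ ord0 k]/(coord _ k) xk; have := kA k; rewrite ltr_norml; lra.
  apply: (lt_le_trans MA); apply: le_trans (coord_le_norm x k).
  by rewrite -/(coord _ _) xk ler_norm.
by move=> /eqP; rewrite subr_eq0 => /eqP; exists x.
Qed.

End NoEscape.

(** * Retraction onto a ball *)

Section Retraction.
Import Order.TTheory GRing.Theory Num.Theory.
Import numFieldNormedType.Exports.
Local Open Scope ring_scope.
Local Open Scope classical_set_scope.
Variable R : realType.
Local Notation pt := 'rV[R]_3.
Local Notation coord := Defs.coord.
Implicit Types X U : set pt.

Lemma row3_continuous (T : topologicalType) (h : 'I_3 -> T -> R) :
  (forall i, continuous (h i)) -> continuous (fun x : T => (\row_i h i x) : pt).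
Proof.
move=> ch x; apply/cvgrPdist_lt => e e0.
have near_i i : \forall y \near x, `|h i x - h i y| < e.
  by move: e e0; apply/cvgrPdist_lt; apply: ch.
near=> y; apply: norm_lt_coord => //; apply: ord3P; rewrite !mxE; near: y; exact: near_i.
Unshelve. all: by end_near. Qed.

Definition sqnorm (y : pt) : R := coord y c0 ^+ 2 + coord y c1 ^+ 2 + coord y c2 ^+ 2.

Lemma sqr_coord_le y i : coord y i ^+ 2 <= sqnorm y.
Proof.
rewrite /sqnorm; move: i; apply: ord3P.
- by rewrite -addrA lerDl addr_ge0 // sqr_ge0.
- by rewrite addrAC lerDr addr_ge0 // sqr_ge0.
- by rewrite lerDr addr_ge0 // sqr_ge0.
Qed.

Lemma within_comp_continuous (S T W : topologicalType) (f : S -> T) (g : T -> W) (B : set T) :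
  continuous f -> (forall x, B (f x)) -> {within B, continuous g} -> continuous (g \o f).
Proof.
move=> cf fB /subspace_continuousP cg x.
apply: (@cvg_comp _ _ _ f g _ (within B (nbhs (f x)))); last exact: cg.
move=> A gA; have h : \forall y \near x, (B (f y) -> A (f y)) := cf x _ gA.
by apply: (@filterS _ (nbhs x) _ _ _ _ h) => y; apply.
Qed.

Lemma ball_retract X : closed X -> homeomorphic X (@closed_ball3 R) ->
  exists r : pt -> pt, [/\ continuous r, forall x, X (r x) & forall x, X x -> r x = x].
Proof.
move=> clX [f [g [[fX gB] gf fg cf cg]]].
have /choice[h hP] : forall i : 'I_3, exists h : pt -> R,
    continuous h /\ forall x, X x -> h x = coord (f x) i.
  move=> i.
  have [||h [h1 h2 h3]] := @continuous_bounded_extension pt R pseudometric_normal X clX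
      (fun x => coord (f x) i) 1 ltr01.
  - move=> x; apply: (@continuous_comp (subspace X) pt R f (fun y : pt => y ord0 i)).
      exact: cf.
    exact: coord_continuous.
  - move=> x /fX fx; rewrite -(@ler_pXn2r _ 2) ?nnegrE // expr1n.
    by rewrite real_normK ?num_real //; apply: le_trans (sqr_coord_le _ _) fx.
  by exists h; split=> // x Xx; rewrite h1 // inE.
pose q x := sqnorm (\row_i h i x).
(* Identity on the ball, inversion outside: the squared norm [q] becomes [1/q]. Dividing by [q]
   rather than by its root avoids square roots. *)
pose PH x : pt := \row_i ((Num.max 1 (q x))^-1 * h i x).
have qE x : q x = h c0 x ^+ 2 + h c1 x ^+ 2 + h c2 x ^+ 2 by rewrite /q /sqnorm /coord !mxE.
have ch i : continuous (h i) by have [] := hP i.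
have cq : continuous q.
  have -> : q = (fun x => h c0 x * h c0 x + h c1 x * h c1 x + h c2 x * h c2 x).
    by apply/funext => x; rewrite qE !expr2.
  have chh i : continuous (fun x => h i x * h i x).
    by move=> x; apply: (@continuousM _ _ (h i) (h i)); apply: ch.
  move=> x; apply: (@continuousD _ _ _ (fun x => h c0 x * h c0 x + h c1 x * h c1 x));
    last exact: chh.
  apply: (@continuousD _ _ _ (fun x => h c0 x * h c0 x)); exact: chh.
have m0 x : 0 < Num.max 1 (q x) by rewrite lt_max ltr01.
have cm : continuous (fun x => (Num.max 1 (q x))^-1).
  move=> x; apply: (@continuousV _ _ (fun x => Num.max 1 (q x))); first by rewrite gt_eqF.
  by apply: continuous_max; [exact: cst_continuous|exact: cq].
have cPH : continuous PH.
  by apply: row3_continuous => i x; apply: (@continuousM _ _ _ (h i)); [exact: cm|exact: ch].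
have PHB x : closed_ball3 (PH x).
  rewrite /closed_ball3 /= /coord !mxE !exprMn -!mulrDr -qE.
  have [q1|q1] := leP (q x) 1; first by rewrite invr1 expr1n mul1r.
  by rewrite expr2 -mulrA mulVf ?gt_eqF // ?(lt_trans ltr01) // mulr1
    invf_le1 ?ltW // (lt_trans ltr01).
exists (g \o PH); split.
- exact: within_comp_continuous cPH PHB cg.
- by move=> x; apply: gB.
move=> x Xx /=; rewrite -[RHS](gf x Xx); congr g.
have hE i : h i x = coord (f x) i by have [_ ->] := hP i.
have q1 : q x <= 1 by rewrite qE !hE; apply: fX.
by apply/rowP => i; rewrite mxE hE max_l // invr1 mul1r.
Qed.

Lemma no_bounded_hole X U : closed X -> homeomorphic X (@closed_ball3 R) ->
  open U -> X `&` U = set0 -> open (~` (X `|` U)) -> bounded_set U -> U = set0.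
Proof.
move=> clX hX oU XU oE bU; have [r [cr rX rid]] := ball_retract clX hX.
rewrite -subset0 => x0 Ux0.
pose G (x : pt) : pt := if x \in U then r x else x.
have cG : continuous G.
  move=> x; apply: (iffRL (@cvgrPdist_lt _ pt pt (nbhs x) _ G (G x))) => e e0.
  have nr : \forall y \near x, `|r x - r y| < e :=
    iffLR (@cvgrPdist_lt _ pt pt (nbhs x) _ r (r x)) (cr x) e e0.
  have ni : \forall y \near x, `|x - y| < e.
    by have := nbhsx_ballx x e e0; rewrite -ball_normE.
  (* At a point of [X] both branches of [G] tend to [x], since [r] fixes it. Elsewhere [U] or the
     complement of the union is an open neighbourhood on which a single branch applies. *)
  have [Xx|nXx] := pselect (X x).
    have Gx : G x = x.
      rewrite /G ifN //; apply/negP; rewrite inE => Ux.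
      by have : (X `&` U) x by []; rewrite XU.
    near=> y; rewrite Gx /G; case: ifP => _; last by near: y.
    suff: `|r x - r y| < e by rewrite rid.
    by near: y; exact: nr.
  have [Ux|nUx] := pselect (U x).
    have nU : \forall y \near x, U y by apply: open_nbhs_nbhs.
    near=> y; have Uy : U y by near: y.
    by rewrite /G !mem_set //; near: y; exact: nr.
  have nE : \forall y \near x, (~` (X `|` U)) y by apply: open_nbhs_nbhs; split=> // -[].
  near=> y; have Ey : (~` (X `|` U)) y by near: y.
  have nUy : ~ U y by move=> Uy; apply: Ey; right.
  by rewrite /G !memNset //; near: y; exact: ni.
have [M [_ bM]] := bU.
have [|x] := @surjective_of_id_far R G (M + 1) x0 cG.
  move=> x Mx; rewrite /G memNset // => Ux.
  by have := bM (M + 1) (ltr_pwDr ltr01 (lexx M)) x Ux; rewrite /= leNgt Mx.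
rewrite /G; case: ifPn => [_ E|].
  have : (X `&` U) x0 by split; rewrite // -E; apply: rX.
  by rewrite XU.
by rewrite notin_setE => nU E; apply: nU; rewrite E.
Unshelve. all: by end_near. Qed.

End Retraction.

(** * Crossings of a segment with a tetrahedron *)

Section Affine.
Import Order.TTheory GRing.Theory Num.Theory.
Import numFieldNormedType.Exports.
Local Open Scope ring_scope.
Variable R : realType.
Local Notation pt := 'rV[R]_3.

Section Parity1D.
Variables (W : eqType) (al ga : W -> R).
Let f v (r : R) := al v + r * ga v.

(** With barycentric coordinates along a segment for the functions [f v], positivity means lying
    inside the simplex, and [crosses] means passing through the facet opposite to [v]. *)
Definition positive_at (l : seq W) r := all (fun v => 0 < f v r) l.
Definition crosses (l : seq W) v x y : bool := `[< exists r, [/\ x <= r <= y, f v r = 0 &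
  forall w, w \in l -> w != v -> 0 < f w r] >].

Lemma positive_at_cons u l r : positive_at (u :: l) r = (0 < f u r) && positive_at l r.
Proof. by []. Qed.

Lemma affine_gt0 v x y r : x <= r <= y -> 0 < f v x -> 0 < f v y -> 0 < f v r.
Proof.
rewrite /f => /andP[xr ry] fx fy; have [g0|g0] := leP 0 (ga v).
  by apply: lt_le_trans fx _; rewrite lerD2l ler_wpM2r.
by apply: lt_le_trans fy _; rewrite lerD2l ler_wnM2r // ltW.
Qed.

Lemma affine_lt0 v x y r : x <= r <= y -> f v x < 0 -> f v y < 0 -> f v r < 0.
Proof.
rewrite /f => /andP[xr ry] fx fy; have [g0|g0] := leP 0 (ga v).
  by apply: le_lt_trans fy; rewrite lerD2l ler_wpM2r.
by apply: le_lt_trans fx; rewrite lerD2l ler_wnM2r // ltW.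
Qed.

Lemma affine_zero v x y : x <= y -> 0 < f v x -> f v y < 0 ->
  exists c, [/\ x <= c <= y, f v c = 0,
    forall r, (0 < f v r) = (r < c) & forall r, f v r = 0 -> r = c].
Proof.
rewrite /f => xy fx fy.
have g0 : ga v < 0 by rewrite ltNge; apply/negP => g0; have := ler_wpM2r g0 xy; lra.
exists (- al v / ga v); split.
- apply/andP; split; first by rewrite ler_ndivlMr //; lra.
  by rewrite ler_ndivrMr //; lra.
- by rewrite divfK ?lt_eqF // subrr.
- by move=> r; rewrite ltr_ndivlMr // addrC -ltrBlDr sub0r.
- by move=> r h; apply: (canRL (mulfK _)); [rewrite lt_eqF|lra].
Qed.

Lemma affine_zero_rev v x y : x <= y -> f v x < 0 -> 0 < f v y ->
  exists c, [/\ x <= c <= y, f v c = 0,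
    forall r, (0 < f v r) = (c < r) & forall r, f v r = 0 -> r = c].
Proof.
rewrite /f => xy fx fy.
have g0 : 0 < ga v by rewrite ltNge; apply/negP => g0; have := ler_wnM2r g0 xy; lra.
exists (- al v / ga v); split.
- apply/andP; split; first by rewrite ler_pdivlMr //; lra.
  by rewrite ler_pdivrMr //; lra.
- by rewrite divfK ?gt_eqF // subrr.
- by move=> r; rewrite ltr_pdivrMr // addrC -ltrBlDr sub0r.
- by move=> r h; apply: (canRL (mulfK _)); [rewrite gt_eqF|lra].
Qed.

Lemma crosses_self u l c x y : u \notin l -> x <= c <= y -> f u c = 0 ->
  (forall r, f u r = 0 -> r = c) -> crosses (u :: l) u x y = positive_at l c.
Proof.
move=> ul xcy fc uc; apply/asboolP/allP => [[r [_ /uc-> h]] w wl|h].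
  by apply: h; rewrite ?inE ?wl ?orbT //; apply: contraNneq ul => <-.
exists c; split=> // w; rewrite inE => /orP[->//|wl] _; exact: h.
Qed.

Lemma segment_crossings l x y : uniq l -> x <= y ->
  (forall v, v \in l -> f v x != 0 /\ f v y != 0) ->
  (forall v w r, v \in l -> w \in l -> v != w -> x <= r <= y -> ~ (f v r = 0 /\ f w r = 0)) ->
  positive_at l x (+) positive_at l y = \big[addb/false]_(v <- l) crosses l v x y.
Proof.
elim: l x y => [|u l IH] x y; first by rewrite big_nil.
rewrite cons_uniq => /andP[ul uniql] xy ends gen; rewrite big_cons.
have [fx fy] := ends u (mem_head _ _).
have endsl v : v \in l -> f v x != 0 /\ f v y != 0.
  by move=> vl; apply: ends; rewrite inE vl orbT.
have genl x' y' : x <= x' -> y' <= y -> forall v w r, v \in l -> w \in l -> v != w ->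
    x' <= r <= y' -> ~ (f v r = 0 /\ f w r = 0).
  move=> xx yy v w r vl wl vw /andP[xr ry]; apply: gen; rewrite ?inE ?vl ?wl ?orbT //.
  by rewrite (le_trans xx) // (le_trans ry).
have nul v : v \in l -> u != v by move=> vl; apply: contraNneq ul => ->.
have sameP v x' y' : v \in l ->
    (forall r, f v r = 0 -> (x <= r <= y) && (0 < f u r) = (x' <= r <= y')) ->
    crosses (u :: l) v x y = crosses l v x' y'.
  move=> vl h; apply: asbool_equiv_eq; split=> -[r [rr fr pr]]; exists r.
    split=> //; first by rewrite -h // rr pr ?inE ?eqxx // nul.
    by move=> w wl; apply: pr; rewrite inE wl orbT.
  move: rr; rewrite -h // => /andP[rr ur]; split=> // w.
  by rewrite inE => /orP[/eqP-> //|wl]; apply: pr.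
have fuN v c : v \in l -> x <= c <= y -> f u c = 0 -> f v c != 0.
  move=> vl xc uc; apply/eqP => vc; apply: (gen u v c) => //; rewrite ?inE ?eqxx ?vl ?orbT //.
  exact: nul.
have [ux|ux|ux0] := ltgtP 0 (f u x); last by rewrite -ux0 eqxx in fx.
  have [uy|uy|uy0] := ltgtP 0 (f u y); last by rewrite -uy0 eqxx in fy.
    rewrite !positive_at_cons ux uy /= IH //; last exact: genl.
    have -> : crosses (u :: l) u x y = false.
      by apply/asboolP => -[r [/(affine_gt0) /(_ ux uy)+ fr _]]; rewrite fr ltxx.
    rewrite addFb !big_seq; apply: eq_bigr => v vl; apply/esym/sameP => // r _.
    by case xry: (_ <= _ <= _) => //=; apply: affine_gt0 xry ux uy.
  have [c [xcy uc up uz]] := affine_zero xy ux uy; have [/andP[xc cy]] := (xcy, tt).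
  rewrite (crosses_self ul xcy uc uz) !positive_at_cons ux (lt_gtF uy) /= addbF.
  have := IH x c uniql xc _ (genl _ _ (lexx x) cy).
  move=> /(_ (fun v vl => conj (endsl v vl).1 (fuN v c vl xcy uc))).
  rewrite (_ : \big[addb/false]_(v <- l) crosses l v x c =
      \big[addb/false]_(v <- l) crosses (u :: l) v x y); last first.
    rewrite !big_seq; apply: eq_bigr => v vl; apply/esym/sameP => // r vr.
    rewrite up; apply/idP/idP => [/andP[/andP[-> _] /ltW]//|/andP[xr rc]].
    rewrite xr (le_trans rc cy) /= lt_neqAle rc andbT; apply: contraTneq isT => rE.
    by case/eqP: (fuN v c vl xcy uc); rewrite -rE.
  by move=> <-; case: (positive_at l x); case: (positive_at l c); case: (positive_at l y).
have [uy|uy|uy0] := ltgtP 0 (f u y); last by rewrite -uy0 eqxx in fy.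
  have [c [xcy uc up uz]] := affine_zero_rev xy ux uy; have [/andP[xc cy]] := (xcy, tt).
  rewrite (crosses_self ul xcy uc uz) !positive_at_cons uy (lt_gtF ux) /=.
  have := IH c y uniql cy _ (genl _ _ xc (lexx y)).
  move=> /(_ (fun v vl => conj (fuN v c vl xcy uc) (endsl v vl).2)).
  rewrite (_ : \big[addb/false]_(v <- l) crosses l v c y =
      \big[addb/false]_(v <- l) crosses (u :: l) v x y); last first.
    rewrite !big_seq; apply: eq_bigr => v vl; apply/esym/sameP => // r vr.
    rewrite up; apply/idP/idP => [/andP[/andP[_ ->] /ltW ->]//|/andP[cr ry]].
    rewrite ry (le_trans xc cr) /= lt_neqAle cr andbT; apply: contraTneq isT => rE.
    by case/eqP: (fuN v c vl xcy uc); rewrite rE.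
  by move=> <-; case: (positive_at l x); case: (positive_at l c); case: (positive_at l y).
rewrite !positive_at_cons (lt_gtF ux) (lt_gtF uy) /=.
have un r : x <= r <= y -> f u r < 0 by move=> xr; apply: affine_lt0 xr ux uy.
have -> : crosses (u :: l) u x y = false.
  by apply/asboolP => -[r [/un + fr _]]; rewrite fr ltxx.
rewrite big_seq big1 // => v vl; apply/asboolP => -[r [/un ur _ /(_ u)]].
by rewrite inE eqxx nul // => /(_ isT isT); rewrite (lt_gtF ur).
Qed.

End Parity1D.
End Affine.

(** * Barycentric coordinates as affine forms on space *)

Section Barycentric.
Import mathcomp.boot.fintype mathcomp.boot.finset.
Import Order.TTheory GRing.Theory Num.Theory.
Import numFieldNormedType.Exports.
Local Open Scope ring_scope.
Variable R : realType.
Local Notation pt := 'rV[R]_3.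

Definition lin (h : 'cV[R]_3 * R) (x : pt) : R := (x *m h.1) ord0 ord0 + h.2.

Definition line (a b : pt) (r : R) : pt := a + r *: (b - a).

Lemma line0 a b : line a b 0 = a. Proof. by rewrite /line scale0r addr0. Qed.
Lemma line1 a b : line a b 1 = b. Proof. by rewrite /line scale1r addrC subrK. Qed.

Lemma lin_line h a b r : lin h (line a b r) = lin h a + r * (lin h b - lin h a).
Proof.
rewrite /lin /line mulmxDl -scalemxAl mulmxBl !mxE; ring.
Qed.

Variables (W : finType) (p : W -> pt).
Implicit Types (s t e g : {set W}) (x : pt).

Definition aff s x := exists c : W -> R,
  \sum_(v in s) c v = 1 /\ x = \sum_(v in s) c v *: p v.

Lemma sum_sub (M : lmodType R) s t (c : W -> R) (F : W -> M) : s \subset t ->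
  \sum_(v in s) c v *: F v = \sum_(v in t) (if v \in s then c v else 0) *: F v.
Proof.
move=> /subsetP st; rewrite big_mkcond [RHS]big_mkcond; apply: eq_bigr => v _ /=.
by case: ifP => [/st ->//|_]; case: ifP; rewrite ?scale0r.
Qed.

Lemma sum_sub1 s t (c : W -> R) : s \subset t ->
  \sum_(v in s) c v = \sum_(v in t) (if v \in s then c v else 0).
Proof.
move=> /subsetP st; rewrite big_mkcond [RHS]big_mkcond; apply: eq_bigr => v _ /=.
by case: ifP => [/st ->//|_]; case: ifP.
Qed.

Lemma hull_aff s x : hull p s x -> aff s x.
Proof. by move=> [c [_ c1 xE]]; exists c. Qed.

Definition barycentric t (b : W -> 'cV[R]_3 * R) := forall x,
  \sum_(v in t) lin (b v) x = 1 /\ \sum_(v in t) lin (b v) x *: p v = x.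

(** The rows [(p v, 1)] form a square matrix, invertible by affine independence; the columns of its
    inverse are the affine forms. *)
Lemma barycentric_exists t : #|t| = 4 -> affinely_independent p t ->
  exists b, barycentric t b.
Proof.
move=> ct ai.
have /card_gt0P[v0 v0t] : (0 < #|t|)%N by rewrite ct.
pose M : 'M[R]_(#|t|, 3 + 1) :=
  row_mx (\matrix_(i < #|t|) p (enum_val i)) (const_mx 1).
have rfM : row_free M.
  apply: inj_row_free => u; rewrite mul_mx_row => /eqP.
  rewrite row_mx_eq0 => /andP[/eqP u1 /eqP u2].
  pose c v := u ord0 (enum_rank_in v0t v).
  have cE i : c (enum_val i) = u ord0 i by rewrite /c enum_valK_in.
  have h1 : \sum_(v in t) c v = 0.
    rewrite (big_enum_val c); move/rowP: u2 => /(_ ord0); rewrite !mxE => u20; rewrite -[RHS]u20.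
    by apply: eq_bigr => i _; rewrite cE mxE mulr1.
  have h2 : \sum_(v in t) c v *: p v = 0.
    rewrite (big_enum_val (fun v => c v *: p v)) -[RHS]u1 mulmx_sum_row.
    by apply: eq_bigr => i _; rewrite cE rowK.
  by apply/rowP => i; rewrite -cE (ai c h1 h2) ?mxE //; apply: enum_valP.
have /row_fullP[B BM] : row_full M by move: rfM; rewrite /row_free /row_full => /eqP->; rewrite ct.
pose U := usubmx B; pose D := dsubmx B.
pose b v := (col (enum_rank_in v0t v) U, D ord0 (enum_rank_in v0t v)).
exists b => x.
have bE i : lin (b (enum_val i)) x = (x *m U + D) ord0 i.
  rewrite /lin /b /= enum_valK_in !mxE; congr (_ + _).
  by apply: eq_bigr => k _; rewrite [col _ _ _ _]mxE.
have : (x *m U + D) *m M = row_mx x 1%:M.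
  rewrite (_ : x *m U + D = row_mx x 1%:M *m B); first by rewrite -mulmxA BM mulmx1.
  by rewrite -[B]vsubmxK mul_row_col mul1mx.
rewrite mul_mx_row => /eq_row_mx[h1 h2]; split.
  rewrite (big_enum_val (fun v => lin (b v) x)).
  move/rowP: h2 => /(_ ord0); rewrite [LHS]mxE [RHS]mxE eqxx => h20; rewrite -[RHS]h20.
  by apply: eq_bigr => i _; rewrite bE [const_mx _ _ _]mxE mulr1.
rewrite (big_enum_val (fun v => lin (b v) x *: p v)) -[RHS]h1 mulmx_sum_row.
by apply: eq_bigr => i _; rewrite bE rowK.
Qed.

Lemma affine_coef_uniq t (c d : W -> R) : affinely_independent p t ->
  \sum_(v in t) c v = \sum_(v in t) d v ->
  \sum_(v in t) c v *: p v = \sum_(v in t) d v *: p v ->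
  forall v, v \in t -> c v = d v.
Proof.
move=> ai e1 e2 v vt; apply/eqP; rewrite -subr_eq0; apply/eqP.
apply: (ai (fun v => c v - d v)) => //; first by rewrite sumrB e1 subrr.
by under eq_bigr do rewrite scalerBl; rewrite sumrB e2 subrr.
Qed.

Section Tetrahedron.
Variables (t : {set W}) (b : W -> 'cV[R]_3 * R).
Hypotheses (ait : affinely_independent p t) (bt : barycentric t b).
Let be v x := lin (b v) x.

Lemma barycentric_coef s (c : W -> R) x : s \subset t ->
  \sum_(v in s) c v = 1 -> x = \sum_(v in s) c v *: p v ->
  forall v, v \in t -> be v x = if v \in s then c v else 0.
Proof.
move=> st c1 xE; apply: affine_coef_uniq => //; have [b1 b2] := bt x.
  by rewrite b1 -sum_sub1.
by rewrite b2 -sum_sub.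
Qed.

Lemma aff_barycentric s x : s \subset t ->
  aff s x <-> (forall v, v \in t -> v \notin s -> be v x = 0).
Proof.
move=> st; split=> [[c [c1 xE]] v vt vs|b0].
  by rewrite (barycentric_coef st c1 xE) // (negPf vs).
have bE v : v \in t -> (if v \in s then be v x else 0) = be v x.
  by move=> vt; case: ifPn => // vs; rewrite b0.
exists (fun v => be v x); have [b1 b2] := bt x.
rewrite (sum_sub1 _ st) (sum_sub _ _ st); split.
  by rewrite -[RHS]b1; apply: eq_bigr => v /bE.
by rewrite -[LHS]b2; apply: eq_bigr => v /bE ->.
Qed.

Lemma hull_barycentric s x : s \subset t ->
  hull p s x <-> (forall v, v \in t -> v \notin s -> be v x = 0) /\
                 (forall v, v \in s -> 0 <= be v x).
Proof.
move=> st; split=> [hx|[b0 bp]].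
  split; first by apply/aff_barycentric => //; apply: hull_aff.
  case: hx => c [c0 c1 xE] v vs.
  by rewrite (barycentric_coef st c1 xE) ?vs // (subsetP st).
have bE v : v \in t -> (if v \in s then be v x else 0) = be v x.
  by move=> vt; case: ifPn => // vs; rewrite b0.
exists (fun v => if v \in s then be v x else 0); have [b1 b2] := bt x.
have i v : v \in s -> (if v \in s then be v x else 0) = be v x by move=> ->.
split; first by move=> v; case: ifP => // /bp.
  rewrite (eq_bigr _ i) (sum_sub1 _ st) -[RHS]b1.
  by apply: eq_bigr => v /bE.
rewrite (eq_bigr (fun v => be v x *: p v)) => [|v /i -> //].
by rewrite (sum_sub _ _ st) -[LHS]b2; apply: eq_bigr => v /bE ->.
Qed.

End Tetrahedron.

(** A generic point lies on no facet plane; a generic segment also misses the lines through edges,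
    so it crosses facets only in their relative interior. *)
Definition generic x := forall g, (#|g| <= 3)%N -> ~ aff g x.

Definition generic_segment (a b : pt) := [/\ generic a, generic b &
  forall e r, (#|e| <= 2)%N -> 0 <= r <= 1 -> ~ aff e (line a b r)].

Definition inh s x : bool := `[< hull p s x >].
Definition hits a b s : bool := `[< exists r, 0 <= r <= 1 /\ hull p s (line a b r) >].

Lemma segment_parity t a b : #|t| = 4 -> affinely_independent p t -> generic_segment a b ->
  inh t a (+) inh t b = \big[addb/false]_(v in t) hits a b (t :\ v).
Proof.
move=> ct ai [ga gb gs]; have [be bt] := barycentric_exists ct ai.
pose al v := lin (be v) a; pose gm v := lin (be v) b - lin (be v) a.
have fE v r : al v + r * gm v = lin (be v) (line a b r) by rewrite lin_line.
have f0 v : al v + 0 * gm v = lin (be v) a by rewrite fE line0.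
have f1 v : al v + 1 * gm v = lin (be v) b by rewrite fE line1.
have c1 v : v \in t -> #|t :\ v| = 3 by move=> vt; move: ct; rewrite (cardsD1 v) vt => -[].
have n0 x v : generic x -> v \in t -> lin (be v) x != 0.
  move=> gx vt; apply/eqP => v0; apply: (gx (t :\ v)); first by rewrite c1.
  apply/(aff_barycentric ai bt); first exact: subsetDl.
  by move=> w wt; rewrite !inE wt andbT negbK => /eqP->.
have inhE x : generic x -> inh t x = all (fun v => 0 < lin (be v) x) (enum t).
  move=> gx; apply/asboolP/allP => [/(hull_barycentric ai bt _ (subxx t))[_ h] v|h].
    by rewrite mem_enum => vt; rewrite lt_neqAle eq_sym n0 // h.
  apply/(hull_barycentric ai bt _ (subxx t)); split=> [v vt|v vt]; first by rewrite vt.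
  by apply: ltW; apply: h; rewrite mem_enum.
have n2 v w r : v \in t -> w \in t -> v != w -> 0 <= r <= 1 ->
    ~ (al v + r * gm v = 0 /\ al w + r * gm w = 0).
  move=> vt wt vw r01; rewrite !fE => -[v0 w0].
  apply: (gs (t :\ v :\ w) r) => //.
    by move: (c1 v vt); rewrite (cardsD1 w) !inE eq_sym vw wt add1n => -[->].
  apply/(aff_barycentric ai bt); first by apply: subset_trans (subsetDl _ _) (subsetDl _ _).
  by move=> u ut; rewrite !inE ut andbT negb_and !negbK => /orP[]/eqP->.
have := @segment_crossings _ _ al gm (enum t) 0 1 (enum_uniq t) ler01.
rewrite big_enum /=.
have -> : positive_at al gm (enum t) 0 = inh t a.
  by rewrite inhE //; apply: eq_all => v /=; rewrite f0.
have -> : positive_at al gm (enum t) 1 = inh t b.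
  by rewrite inhE //; apply: eq_all => v /=; rewrite f1.
move=> ->; first last.
- by move=> v w r; rewrite !mem_enum; apply: n2.
- by move=> v; rewrite mem_enum f0 f1 => vt; split; apply: n0.
apply: eq_bigr => v vt; apply: asbool_equiv_eq; split=> -[r].
  move=> [r01 v0 h]; exists r; split=> //; apply/(hull_barycentric ai bt); first exact: subsetDl.
  split=> w; first by move=> wt; rewrite !inE wt andbT negbK => /eqP->; rewrite -fE.
  by rewrite !inE => /andP[wv wt]; rewrite -fE ltW // h // mem_enum.
move=> [r01 /(hull_barycentric ai bt _ (subsetDl _ _))[h1 h2]]; exists r; split=> //.
  by rewrite fE h1 // !inE eqxx.
move=> w; rewrite mem_enum => wt wv; rewrite lt_neqAle fE h2 ?inE ?wv // andbT eq_sym.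
apply/eqP => w0; apply: (n2 v w r) => //; first by rewrite eq_sym.
by split; rewrite fE // h1 // !inE eqxx.
Qed.

End Barycentric.

(** * General position *)

Section GenericPosition.
Import mathcomp.boot.fintype mathcomp.boot.finset.
Import Order.TTheory GRing.Theory Num.Theory.
Import numFieldNormedType.Exports.
Local Open Scope ring_scope.
Variable R : realType.
Local Notation pt := 'rV[R]_3.

(** At most three linear conditions on four coefficients leave a nonzero solution. *)
Lemma plane_through (l : seq pt) : (size l <= 3)%N ->
  exists h : 'cV[R]_3 * R, h.1 != 0 /\ forall y, y \in l -> lin h y = 0.
Proof.
move=> l3; case: (posnP (size l)) => [/size0nil ->|l0].
  exists (const_mx 1, 0); split=> //=; apply/eqP => /colP/(_ ord0); rewrite !mxE.
  by apply/eqP; rewrite oner_eq0.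
pose M : 'M[R]_(size l, 3 + 1) := row_mx (\matrix_(i < size l) l`_i) (const_mx 1).
have : cokermx M != 0.
  rewrite -mxrank_eq0 mxrank_coker -lt0n subn_gt0.
  by apply: leq_ltn_trans (rank_leq_row M) _; rewrite addn1 ltnS.
move=> /eqP C0.
have [j Cj] : exists j, col j (cokermx M) != 0.
  apply: contrapT => /forallNP no; apply: C0; apply/matrixP => i j.
  have /negP := no j; rewrite negbK => /eqP/colP/(_ i); by rewrite !mxE.
set c := col j (cokermx M) in Cj.
have Mc : M *m c = 0 by rewrite /c colE mulmxA mulmx_coker mul0mx.
pose h : 'cV[R]_3 * R := (usubmx (c : 'cV_(3 + 1)), (dsubmx (c : 'cV_(3 + 1))) ord0 ord0).
have hl y : y \in l -> lin h y = 0.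
  move=> yl; have il : (index y l < size l)%N by rewrite index_mem.
  move/colP: Mc => /(_ (Ordinal il)); rewrite -[c]vsubmxK mul_row_col [LHS]mxE [RHS]mxE => <-.
  rewrite /lin /h /=; congr (_ + _); last by rewrite !mxE big_ord1 !mxE mul1r.
  rewrite [LHS]mxE [RHS]mxE; apply: eq_bigr => k _; by rewrite !mxE nth_index.
(* If the linear part vanished, evaluation at a point of [l] would kill the constant as well. *)
exists h; split=> //; apply/eqP => h0.
have := hl l`_0 (mem_nth _ l0); rewrite /lin h0 mulmx0 mxE add0r => d0.
have u0 : usubmx (c : 'cV_(3 + 1)) = 0 by exact: h0.
have v0 : dsubmx (c : 'cV_(3 + 1)) = 0 by apply/colP => i; rewrite ord1 [RHS]mxE.
by case/eqP: Cj; rewrite -[c]vsubmxK u0 v0 col_mx0.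
Qed.

Lemma lin_continuous (h : 'cV[R]_3 * R) : continuous (lin h).
Proof.
have -> : lin h = (fun x => x ord0 c0 * h.1 c0 ord0 + x ord0 c1 * h.1 c1 ord0 +
    x ord0 c2 * h.1 c2 ord0 + h.2).
  apply/funext => x; rewrite /lin mxE !big_ord_recl big_ord0 addr0 addrA.
  by congr (_ * _ + _ * _ + _ * _ + _); congr (_ _ _); apply: val_inj.
have cM (i : 'I_3) : continuous (fun x : pt => x ord0 i * h.1 i ord0).
  move=> x; apply: (@continuousM _ _ (fun x : pt => x ord0 i) (fun=> h.1 i ord0)).
    exact: coord_continuous.
  exact: cst_continuous.
move=> x; apply: (@continuousD _ _ _ (fun x : pt =>
    x ord0 c0 * h.1 c0 ord0 + x ord0 c1 * h.1 c1 ord0 + x ord0 c2 * h.1 c2 ord0) (fun=> h.2)); last exact: cst_continuous.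
apply: (@continuousD _ _ _ (fun x : pt =>
    x ord0 c0 * h.1 c0 ord0 + x ord0 c1 * h.1 c1 ord0)); last exact: cM.
by apply: (@continuousD _ _ _ (fun x : pt => x ord0 c0 * h.1 c0 ord0)); apply: cM.
Qed.

Lemma open_lin_neq0 h : open (fun x : pt => lin h x != 0).
Proof.
apply: (@open_comp _ _ (lin h) (fun r : R => r != 0)); last exact: open_neq.
by move=> x _; apply: lin_continuous.
Qed.

Lemma open_lin_gt0 h : open (fun x : pt => 0 < lin h x).
Proof.
apply: (@open_comp _ _ (lin h) (fun r : R => 0 < r)); last exact: open_gt.
by move=> x _; apply: lin_continuous.
Qed.

Lemma open_lin_lt0 h : open (fun x : pt => lin h x < 0).
Proof.
apply: (@open_comp _ _ (lin h) (fun r : R => r < 0)); last exact: open_lt.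
by move=> x _; apply: lin_continuous.
Qed.

Lemma open_line (O : set pt) (a b : pt) : open O -> O a ->
  exists2 e : R, 0 < e & forall r, `|r| < e -> O (line a b r).
Proof.
move=> oO Oa; have /nbhs_ballP[e /= e0 eO] : nbhs a O by apply: open_nbhs_nbhs.
have d0 : 0 < 1 + `|b - a| by rewrite ltr_pwDl.
exists (e / (1 + `|b - a|)); first by rewrite divr_gt0.
move=> r; rewrite ltr_pdivlMr // => re; apply: eO; rewrite -ball_normE /=.
rewrite /line opprD addrA subrr add0r normrN normrZ.
apply: le_lt_trans re; rewrite ler_wpM2l // lerDr //.
Qed.

Lemma avoid_planes (hs : seq ('cV[R]_3 * R)) (O : set pt) x :
  (forall h, h \in hs -> h.1 != 0) -> open O -> O x ->
  exists2 y, O y & forall h, h \in hs -> lin h y != 0.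
Proof.
elim: hs O x => [|h hs IH] O x hs0 oO Ox; first by exists x.
have [y Oy hy] : exists2 y, O y & lin h y != 0.
  have [hx|hx] := eqVneq (lin h x) 0; last by exists x.
  (* Moving along the normal vector changes the form by a multiple of the sum of squares of its
     coefficients. *)
  have [e e0 eO] := open_line (x + h.1^T) oO Ox.
  exists (line x (x + h.1^T) (e / 2)); first by apply: eO; rewrite gtr0_norm ?divr_gt0 //; lra.
  rewrite lin_line hx add0r subr0 mulf_neq0 ?gt_eqF ?divr_gt0 //.
  have := hx; rewrite /lin => hx'; rewrite mulmxDl mxE addrAC hx' add0r.
  have h0 := hs0 h (mem_head _ _).
  rewrite mxE; under eq_bigr do rewrite mxE -expr2.
  rewrite lt_neqAle sumr_ge0 ?andbT => [|i _]; last exact: sqr_ge0.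
  apply: contraNneq h0 => /esym/eqP; rewrite psumr_eq0 => [/allP h2|i _]; last exact: sqr_ge0.
  apply/eqP/colP => i; rewrite mxE; apply/eqP; rewrite -sqrf_eq0.
  by apply: h2; rewrite mem_index_enum.
have [|||z [Oz hz] hsz] := IH (fun z => O z /\ lin h z != 0) y.
- by move=> k kh; apply: hs0; rewrite inE kh orbT.
- by apply: openI => //; apply: open_lin_neq0.
- by [].
by exists z => // k; rewrite inE => /orP[/eqP->|/hsz].
Qed.

Variables (W : finType) (p : W -> pt).

Lemma lin_aff h (s : {set W}) x : (forall v, v \in s -> lin h (p v) = 0) ->
  aff p s x -> lin h x = 0.
Proof.
move=> h0 [c [c1 ->]]; rewrite /lin mulmx_suml summxE.
under eq_bigr => v vs do rewrite -scalemxAl mxE (canRL (addrK _) (h0 v vs)) add0r mulrN.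
by rewrite sumrN -mulr_suml c1 mul1r addNr.
Qed.

Lemma generic_planes : exists2 hs : seq ('cV[R]_3 * R), forall h, h \in hs -> h.1 != 0 &
  forall c, (forall h, h \in hs -> lin h c != 0) -> generic p c.
Proof.
have /choice[h hP] : forall g : {set W}, exists h : 'cV[R]_3 * R, h.1 != 0 /\
    ((#|g| <= 3)%N -> forall v, v \in g -> lin h (p v) = 0).
  move=> g; have [g3|g3] := leqP #|g| 3.
    have [|h [h1 h0]] := @plane_through (map p (enum g)); first by rewrite size_map -cardE.
    by exists h; split=> // _ v vg; apply: h0; rewrite map_f // mem_enum.
  have [h [h1 _]] := @plane_through [::] isT; by exists h.
exists [seq h g | g <- index_enum {set W}] => [_ /mapP[g _ ->]|c cP g g3 cg].
  by case: (hP g).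
have [_ /(_ g3) h0] := hP g; have /eqP := cP (h g) (map_f _ (mem_index_enum _)).
by rewrite (lin_aff h0 cg).
Qed.

(** For each [e] take the plane through [y] and [e]. If [c] is off it, the segment from [y] meets it
    only at [y], which is not on the span of [e]. *)
Lemma segment_planes y : generic p y ->
  exists2 hs : seq ('cV[R]_3 * R), forall h, h \in hs -> h.1 != 0 &
  forall c, (forall h, h \in hs -> lin h c != 0) ->
    forall (e : {set W}) r, (#|e| <= 2)%N -> 0 <= r <= 1 -> ~ aff p e (line y c r).
Proof.
move=> gy.
have /choice[h hP] : forall e : {set W}, exists h : 'cV[R]_3 * R, h.1 != 0 /\
    ((#|e| <= 2)%N -> lin h y = 0 /\ forall v, v \in e -> lin h (p v) = 0).
  move=> e; have [e3|e3] := leqP #|e| 2.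
    have [|h [h1 h0]] := @plane_through (y :: map p (enum e)).
      by rewrite /= size_map -cardE.
    exists h; split=> // _; split=> [|v vg]; apply: h0; rewrite inE ?eqxx //.
    by rewrite map_f ?orbT // mem_enum.
  have [h [h1 _]] := @plane_through [::] isT; by exists h.
exists [seq h g | g <- index_enum {set W}] => [_ /mapP[g _ ->]|c cP e r e2 r01 ye].
  by case: (hP g).
have [_ /(_ e2)[h0 hv]] := hP e; have hc := cP (h e) (map_f _ (mem_index_enum _)).
have := lin_aff hv ye; rewrite lin_line h0 add0r subr0 => /eqP.
rewrite mulf_eq0 (negPf hc) orbF => /eqP r0.
by apply: (gy e); [exact: leqW|move: ye; rewrite r0 line0].
Qed.

Lemma generic_dense (O : set pt) x : open O -> O x -> exists2 c, O c & generic p c.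
Proof.
move=> oO Ox; have [hs hs0 hsP] := generic_planes.
by have [c Oc cP] := avoid_planes hs0 oO Ox; exists c => //; apply: hsP.
Qed.

Lemma generic_pair_dense (a b : pt) (O : set pt) x : generic p a -> generic p b ->
  open O -> O x ->
  exists2 c, O c & generic_segment p a c /\ generic_segment p b c.
Proof.
move=> ga gb oO Ox; have [hs hs0 hsP] := generic_planes.
have [ha ha0 haP] := segment_planes ga; have [hb hb0 hbP] := segment_planes gb.
have [|c Oc cP] := @avoid_planes (hs ++ ha ++ hb) O x _ oO Ox.
  by move=> h; rewrite !mem_cat => /or3P[/hs0|/ha0|/hb0].
have gc : generic p c by apply: hsP => h hh; apply: cP; rewrite mem_cat hh.
exists c => //; split; split=> //.
  by apply: haP => h hh; apply: cP; rewrite !mem_cat hh orbT.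
by apply: hbP => h hh; apply: cP; rewrite !mem_cat hh !orbT.
Qed.

End GenericPosition.

(** * Cones *)

Section FacetSums.
Import mathcomp.boot.fintype mathcomp.boot.finset.
Variables (V : finType).

Lemma sum_facets (F : {set V} -> bool) (t : {set V}) k : #|t| = k.+1 ->
  \big[addb/false]_(v in t) F (t :\ v) =
  \big[addb/false]_(e : {set V} | (#|e| == k) && (e \subset t)) F e.
Proof.
move=> ct; rewrite -(big_imset (h := fun v => t :\ v) F); last first.
  move=> v w vt wt /setP/(_ v); rewrite !inE eqxx vt !andbT /=.
  by move=> /esym h; apply/eqP/negbFE.
apply: eq_bigl => e; apply/imsetP/andP => [[v vt ->]|[/eqP ce et]].
  by move: ct; rewrite (cardsD1 v) vt add1n => -[->]; rewrite subsetDl.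
have /cards1P[v tv] : #|t :\: e| == 1 by rewrite cardsD (setIidPr et) ct ce subSnn.
have : v \in t :\: e by rewrite tv set11.
rewrite inE => /andP[ve vt]; exists v => //.
by rewrite -tv setDDr setDv set0U (setIidPr et).
Qed.

(** Discrete Stokes formula: facets shared by an even number of members of [S] cancel. *)
Lemma sum_boundary (F : {set V} -> bool) (S : {set {set V}}) k :
  (forall t, t \in S -> #|t| = k.+1) ->
  \big[addb/false]_(t in S) \big[addb/false]_(v in t) F (t :\ v) =
  \big[addb/false]_(e : {set V} | #|e| == k) (bd S e && F e).
Proof.
move=> cS; under eq_bigr => t tS do rewrite (sum_facets F (cS t tS)) big_mkcondr.
rewrite exchange_big; apply: eq_bigr => e _; rewrite /bd.
case: (F e); rewrite ?andbT ?andbF; first by apply: eq_bigr => t _; case: ifP.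
by rewrite big1 // => t _; case: ifP.
Qed.

End FacetSums.

Section Cone.
Import mathcomp.boot.fintype mathcomp.boot.finset.
Import Order.TTheory GRing.Theory Num.Theory.
Import numFieldNormedType.Exports.
Local Open Scope ring_scope.
Variable R : realType.
Local Notation pt := 'rV[R]_3.
Variables (V : finType) (p : V -> pt) (q : pt).
Implicit Types (s t e f g : {set V}).

(** The formal apex [None], placed at [q], turns a triangle into a tetrahedron outside the complex,
    to which the affine lemmas apply. *)
Definition cone_pt : option V -> pt := oapp p q.
Definition cone s : {set option V} := None |: [set Some v | v in s].

Lemma None_notin s : None \notin [set Some v | v in s].
Proof. by apply/imsetP => -[]. Qed.

Lemma big_cone (M : Type) (idx : M) (op : Monoid.com_law idx) s (F : option V -> M) :
  \big[op/idx]_(v in cone s) F v = op (F None) (\big[op/idx]_(v in s) F (Some v)).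
Proof. by rewrite big_setU1 ?None_notin //= big_imset // => ? ? _ _ []. Qed.

Lemma sum_cone (M : nmodType) s (F : option V -> M) :
  \sum_(v in cone s) F v = F None + \sum_(v in s) F (Some v).
Proof. exact: big_cone. Qed.

Lemma sum_some (M : nmodType) s (F : option V -> M) :
  \sum_(v in [set Some v | v in s]) F v = \sum_(v in s) F (Some v).
Proof. by rewrite big_imset // => ? ? _ _ []. Qed.

Lemma card_some s : #|[set Some v | v in s]| = #|s|.
Proof. by rewrite card_imset // => ? ? []. Qed.

Lemma card_cone s : #|cone s| = #|s|.+1.
Proof. by rewrite cardsU1 None_notin card_some. Qed.

Lemma aff_some s x : aff p s x -> aff cone_pt [set Some v | v in s] x.
Proof.
by move=> [c [c1 xE]]; exists (fun w => oapp c 0 w); rewrite !sum_some.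
Qed.

Lemma hull_some s x : hull cone_pt [set Some v | v in s] x <-> hull p s x.
Proof.
split=> -[c [c0 c1 xE]].
  by exists (fun v => c (Some v)); split=> //; rewrite -?sum_some // xE sum_some.
by exists (fun w => oapp c 0 w); split; rewrite ?sum_some // => -[v|] /=.
Qed.

Lemma generic_some x : generic cone_pt x -> generic p x.
Proof. by move=> gx g g3 /aff_some; apply: gx; rewrite card_some. Qed.

Lemma generic_segment_some a b : generic_segment cone_pt a b -> generic_segment p a b.
Proof.
move=> [ga gb gs]; split; [exact: generic_some|exact: generic_some|].
by move=> e r e2 r01 /aff_some; apply: gs; rewrite // card_some.
Qed.

Lemma hits_some a b s : hits cone_pt a b [set Some v | v in s] = hits p a b s.
Proof.
by apply: asbool_equiv_eq; split=> -[r [r01 /hull_some h]]; exists r.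
Qed.

Lemma cone_independent s : affinely_independent p s -> ~ aff p s q ->
  affinely_independent cone_pt (cone s).
Proof.
move=> ai nq c; rewrite !sum_cone /= => c1 c2.
have cN : c None = 0.
  apply: contrapT => /eqP cN; apply: nq.
  exists (fun v => - (c None)^-1 * c (Some v)); split.
    rewrite -mulr_sumr (_ : \sum_(v in s) _ = - c None); last first.
      by apply/eqP; rewrite -addr_eq0 addrC c1.
    by rewrite mulrNN mulVf.
  under eq_bigr do rewrite -scalerA; rewrite -scaler_sumr.
  rewrite (_ : \sum_(v in s) _ = - (c None *: q)); last by apply/eqP; rewrite -addr_eq0 addrC c2.
  by rewrite scaleNr scalerN opprK scalerA mulVf // scale1r.
move: c1 c2; rewrite cN scale0r !add0r => c1 c2 v; rewrite !inE => /orP[/eqP->//|/imsetP[w ws ->]].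
exact: (ai (fun w => c (Some w))).
Qed.

Lemma cone_setD1_some s v : cone s :\ Some v = cone (s :\ v).
Proof.
apply/setP => -[w|]; rewrite !inE //=.
have inj : injective (@Some V) by move=> ? ? [].
by rewrite !mem_imset // !inE.
Qed.

End Cone.

Section Bounded.
Import mathcomp.boot.fintype mathcomp.boot.finset.
Import Order.TTheory GRing.Theory Num.Theory.
Import numFieldNormedType.Exports.
Local Open Scope ring_scope.

Lemma hull_bounded (R : realType) (W : finType) (p : W -> 'rV[R]_3) (s : {set W}) x :
  hull p s x -> `|x| <= \sum_v `|p v|.
Proof.
move=> [c [c0 c1 ->]]; apply: le_trans (ler_norm_sum _ _ _) _.
rewrite big_mkcond; apply: ler_sum => v _.
case: ifP => // vs; rewrite normrZ ger0_norm // ler_piMl //.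
by rewrite -c1 (bigD1 v) //= lerDl sumr_ge0.
Qed.

End Bounded.

(** * Winding parity and homology *)

Section Homology.
Import mathcomp.boot.fintype mathcomp.boot.finset.
Import Order.TTheory GRing.Theory Num.Theory.
Import numFieldNormedType.Exports.
Local Open Scope ring_scope.
Variable R : realType.
Local Notation pt := 'rV[R]_3.
Variables (V : finType) (p : V -> pt) (q : pt) (K : {set {set V}}).
Hypotheses (cK : is_simplicial_complex K) (K4 : forall s, s \in K -> (#|s| <= 4)%N).
Hypotheses (gK : geometric_complex K p) (gq : generic p q).
Implicit Types (s t e f g : {set V}) (z S : {set {set V}}).
Local Notation p' := (cone_pt p q).

Lemma triangleP f : f \in triangles K -> f \in K /\ #|f| = 3%N.
Proof. by rewrite inE => /andP[-> /eqP]. Qed.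

Lemma tetrahedronP t : t \in tetrahedra K -> t \in K /\ #|t| = 4%N.
Proof. by rewrite inE => /andP[-> /eqP]. Qed.

Lemma facet_triangle f t : #|f| = 3%N -> t \in K -> f \subset t -> f \in triangles K.
Proof. by move=> cf tK ft; rewrite inE cf eqxx andbT; apply: (cK.2 t) => //; rewrite cf. Qed.

Lemma triangle_cone f : f \in triangles K -> affinely_independent p' (cone f).
Proof.
move=> /triangleP[fK cf]; apply: cone_independent; first exact: gK.1.
by apply: gq; rewrite cf.
Qed.

(* [x] lies in the cone over [f] iff the segment from [q] to [x] meets [f]: this
   is the parity of the number of crossings of that segment with [z]. *)
Definition winding z x := \big[addb/false]_(f in z) inh p' (cone f) x.

(** Each cone has [f] and the cones over the edges of [f] as facets; crossings of the latter cancel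
    because [z] is a cycle. *)
Lemma winding_segment z a b : z \subset triangles K -> two_cycle z ->
  generic_segment p' a b ->
  winding z a (+) winding z b = \big[addb/false]_(f in z) hits p a b f.
Proof.
move=> /subsetP zK zc gab; rewrite /winding -big_split /=.
transitivity (\big[addb/false]_(f in z) (hits p a b f (+)
   \big[addb/false]_(v in f) hits p' a b (cone (f :\ v)))).
  apply: eq_bigr => f /zK fK; have [_ cf] := triangleP fK.
  rewrite segment_parity ?card_cone ?cf //; last exact: triangle_cone.
  rewrite big_cone /= setU1K ?None_notin // hits_some; congr (_ (+) _).
  by apply: eq_bigr => v _; rewrite cone_setD1_some.
rewrite big_split /= (sum_boundary (fun e => hits p' a b (cone e)) (k := 2)); last first.
  by move=> f /zK/triangleP[].
by rewrite [X in _ (+) X]big1 ?addbF // => e /eqP ce; rewrite zc.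
Qed.

Definition convex_set (O : set pt) := forall a b r, O a -> O b -> 0 <= r <= 1 -> O (line a b r).

Lemma ball_convex (x : pt) (e : R) : convex_set (ball x e).
Proof.
move=> a b r; rewrite -ball_normE /= => xa xb /andP[r0 r1].
have -> : x - line a b r = (1 - r) *: (x - a) + r *: (x - b).
  by apply/rowP => i; rewrite /line !mxE; ring.
apply: le_lt_trans (ler_normD _ _) _; rewrite !normrZ !ger0_norm ?subr_ge0 //.
have [->|rn0] := eqVneq r 0; first by rewrite subr0 mul1r mul0r addr0.
have rp : 0 < r by rewrite lt_neqAle eq_sym rn0.
have -> : e = (1 - r) * e + r * e by ring.
by apply: ler_ltD; [rewrite ler_wpM2l ?subr_ge0 // ltW|rewrite ltr_pM2l].
Qed.

(** The segment from [a] to [b] may fail to be generic, hence the detour through a common [c]. *)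
Lemma winding_const z (O : set pt) a b : z \subset triangles K -> two_cycle z ->
  open O -> convex_set O -> (forall f x, f \in z -> O x -> ~ hull p f x) ->
  generic p' a -> generic p' b -> O a -> O b -> winding z a = winding z b.
Proof.
move=> zK zc oO cO Oz ga gb Oa Ob.
have [c Oc [gac gbc]] := generic_pair_dense ga gb oO Oa.
have nohit y : O y -> generic_segment p' y c -> winding z y = winding z c.
  move=> Oy /(winding_segment zK zc); rewrite big1 => [|f fz].
    by case: (winding z y); case: (winding z c).
  by apply/asboolP => -[r [r01 h]]; apply: (Oz f _ fz _ h); apply: cO.
by rewrite !nohit.
Qed.

Lemma winding_outside z x : z \subset triangles K -> two_cycle z ->
  closed (realization K p) -> homeomorphic (realization K p) (@closed_ball3 R) ->
  generic p' x -> ~ realization K p x -> winding z x = false.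
Proof.
move=> zK zc clX hX gx nXx; set X := realization K p in clX hX nXx.
have zX f y : f \in z -> hull p f y -> X y.
  by move=> fz hy; exists f => //=; have [] := triangleP (subsetP zK _ fz).
(* By [winding_const] one odd generic point makes every generic point of the hole odd. *)
pose hole (O : set pt) := [/\ open O, convex_set O, (forall y, O y -> ~ X y) &
  exists y, [/\ O y, generic p' y & winding z y]].
pose U : set pt := fun y => exists2 O, hole O & O y.
have holeW O y : hole O -> O y -> generic p' y -> winding z y.
  move=> [oO cO OX [w [Ow gw Nw]]] Oy gy.
  rewrite (winding_const zK zc oO cO _ gy gw Oy Ow) // => f v fz Ov hv.
  exact: (OX v Ov (zX _ _ fz hv)).
have ball_out y : ~ X y -> exists2 e : R, 0 < e & forall w, ball y e w -> ~ X w.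
  move=> nXy; have : nbhs y (~` X)%classic.
    by apply: open_nbhs_nbhs; split=> //; apply: closed_openC.
  by move=> /nbhs_ballP[e /= e0 eX]; exists e.
have bo (y : pt) (e : R) : open (ball y e) by apply: ball_open_nbhs || apply: ball_open.
suff U0 : U = classical_sets.set0.
  apply/negP => Nx; have [e e0 eX] := ball_out x nXx.
  suff : U x by rewrite U0.
  exists (ball x e); last exact: ballxx.
  split=> //; first exact: ball_convex.
  by exists x; split=> //; apply: ballxx.
apply: (no_bounded_hole clX hX).
- rewrite openE => y [ O hO Oy]; have [oO _ _ _] := hO.
  apply: (@filterS _ _ _ O) => [w Ow|]; first by exists O.
  by apply: open_nbhs_nbhs.
- rewrite -classical_sets.subset0 => y [Xy [ O [_ _ OX _] Oy]]; exact: (OX y Oy Xy).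
- rewrite openE => y /= nXU.
  have nXy : ~ X y by move=> Xy; apply: nXU; left.
  have [e e0 eX] := ball_out y nXy; apply/nbhs_ballP; exists e => //= w yw [|[ O hO Ow]].
    exact: eX.
  apply: nXU; right; have [oO _ _ _] := hO.
  (* If the ball around [y] meets a hole, a generic point of the overlap is odd, so the ball is
     itself a hole and [y] belongs to [U]. *)
  have [v [Ov yv] gv] := generic_dense p' (openI oO (bo y e)) (conj Ow yw).
  exists (ball y e); last exact: ballxx.
  split=> //; first exact: ball_convex.
  by exists v; split=> //; apply: holeW hO Ov gv.
(* Farther out than this sum no cone contains the point, so its parity is even. *)
- exists (\sum_v `|p' v|); split; first exact: num_real.
  move=> M BM y [ O hO Oy] /=; rewrite leNgt; apply/negP => My.
  have [oO _ _ _] := hO.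
  have oM : open (fun w : pt => M < `|w|).
    apply: (@open_comp _ _ (fun w : pt => `|w|) (fun r : R => M < r)); last exact: open_gt.
    by move=> w _; apply: norm_continuous.
  have [v [Ov Mv] gv] := generic_dense p' (openI oO oM) (conj Oy My).
  have := holeW O v hO Ov gv; rewrite /winding big1 // => f _.
  apply/asboolP => /hull_bounded; rewrite leNgt => /negP; apply; exact: lt_trans BM Mv.
Qed.

(** * Tetrahedra and triangles of the complex in general position *)

Lemma interior_open t (b : V -> 'cV[R]_3 * R) :
  open (fun w => forall v, v \in t -> 0 < lin (b v) w).
Proof.
rewrite openE => w wt.
apply: (@filter_forall _ V (fun v y => v \in t -> 0 < lin (b v) y) (nbhs w)) => v.
have [vt|vt] := boolP (v \in t); last by exact: nearW.
have : nbhs w (fun y => 0 < lin (b v) y).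
  by apply: open_nbhs_nbhs; split; [exact: open_lin_gt0|exact: wt].
by apply: filterS.
Qed.

(** Distinct tetrahedra meet in the hull of at most three vertices, which a generic point avoids. *)
Lemma tetrahedron_uniq x t t' : generic p x -> t \in tetrahedra K -> t' \in tetrahedra K ->
  hull p t x -> hull p t' x -> t = t'.
Proof.
move=> gx /tetrahedronP[tK ct] /tetrahedronP[t'K ct'] hx hx'.
apply: contrapT => /eqP tt'.
have hI : hull p (t :&: t') x by rewrite -(gK.2 t t').
apply: (gx (t :&: t')); last exact: hull_aff.
rewrite -ltnS -ct; apply: proper_card; rewrite properEneq subsetIl andbT.
apply: contraNneq tt' => E; rewrite eqEcard ct ct' leqnn andbT -E; exact: subsetIr.
Qed.

Lemma winding_tetrahedron z t x y : z \subset triangles K -> two_cycle z ->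
  t \in tetrahedra K -> generic p' x -> generic p' y -> hull p t x -> hull p t y ->
  winding z x = winding z y.
Proof.
move=> zK zc tK gx gy hx hy; have [tK' ct] := tetrahedronP tK.
have ai := gK.1 t tK'; have [b bt] := barycentric_exists ct ai.
have inside w : generic p' w -> hull p t w -> forall v, v \in t -> 0 < lin (b v) w.
  move=> gw /(hull_barycentric ai bt _ (subxx t))[_ h] v vt; rewrite lt_neqAle h // andbT.
  apply/eqP => b0; apply: (generic_some gw (g := t :\ v)).
    by move: ct; rewrite (cardsD1 v) vt add1n => -[->].
  apply/(aff_barycentric ai bt); first exact: subsetDl.
  by move=> u ut; rewrite !inE ut andbT negbK => /eqP->.
apply: (winding_const (O := fun w => forall v, v \in t -> 0 < lin (b v) w)) => //.
- exact: interior_open.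
- move=> u w r bu bw /andP[r0 r1] v vt; rewrite lin_line.
  have := bu v vt; have := bw v vt; nra.
- move=> f w fz bw hf; have [fK cf] := triangleP (subsetP zK f fz).
  have ht : hull p t w.
    by apply/(hull_barycentric ai bt _ (subxx t)); split=> [v ->//|v vt]; apply/ltW/bw.
  have : hull p (t :&: f) w by rewrite -(gK.2 t f).
  move=> /(hull_barycentric ai bt _ (subsetIl t f))[h0 _].
  (* A triangle misses some vertex [v] of [t]; on the common face the coordinate of [v] is zero, so
     no triangle enters the open tetrahedron. *)
  have /subsetPn[v vt vf] : ~~ (t \subset f).
    by apply/negP => /subset_leq_card; rewrite ct cf.
  by have := bw v vt; rewrite h0 ?ltxx // inE vt.
- exact: inside.
- exact: inside.
Qed.

(** The apex supplies the fourth coordinate, whose vanishing is the equation of the plane of [f]. *)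
Lemma hull_cone_barycentric f b x : f \in triangles K -> barycentric p' (cone f) b ->
  hull p f x <-> lin (b None) x = 0 /\ forall v, v \in f -> 0 <= lin (b (Some v)) x.
Proof.
move=> fK bt; have ai := triangle_cone fK.
have sub : [set Some v | v in f] \subset cone f by apply: subsetUr.
rewrite -(hull_some p q) (hull_barycentric ai bt x sub); split=> -[h1 h2].
  split=> [|v vf]; first by apply: h1; rewrite ?None_notin // !inE.
  by apply: h2; apply: imset_f.
split=> [v|v /imsetP[w wf ->]]; last exact: h2.
by rewrite !inE => /orP[/eqP->//|->].
Qed.

Lemma near_not_hull g c : g \in triangles K -> ~ hull p g c ->
  \forall x \near c, ~ hull p g x.
Proof.
move=> gT ng; have [_ cg] := triangleP gT.
have [||b bt] := @barycentric_exists _ _ p' (cone g); first by rewrite card_cone cg.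
  exact: triangle_cone.
have hE x := hull_cone_barycentric x gT bt.
have [c0|c0] := eqVneq (lin (b None) c) 0; last first.
  have : nbhs c (fun y => lin (b None) y != 0).
    by apply: open_nbhs_nbhs; split; [exact: open_lin_neq0|].
  by apply: filterS => y /eqP y0 /hE[].
have [v vg v0] : exists2 v, v \in g & lin (b (Some v)) c < 0.
  apply: contrapT => no; apply: ng; apply/hE; split=> // v vg.
  by rewrite leNgt; apply/negP => lt; apply: no; exists v.
have : nbhs c (fun y => lin (b (Some v)) y < 0).
  by apply: open_nbhs_nbhs; split; [exact: open_lin_lt0|].
by apply: filterS => y y0 /hE[_ /(_ v vg)]; rewrite leNgt y0.
Qed.

(* The segment is a short one through the barycentre of [f]. *)
Lemma probe f : f \in triangles K -> exists a b, [/\ generic_segment p' a b,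
  hits p a b f & forall g, g \in triangles K -> g != f -> hits p a b g = false].
Proof.
move=> fT; have [fK cf] := triangleP fT.
have ai := triangle_cone fT.
have [|be bt] := @barycentric_exists _ _ p' (cone f) _ ai; first by rewrite card_cone cf.
pose c : pt := \sum_(v in f) 3^-1 *: p v.
have s1 : \sum_(v in f) 3^-1 = 1 :> R by rewrite sumr_const cf -[LHS]mulr_natl mulfV // pnatr_eq0.
have sub : [set Some v | v in f] \subset cone f by apply: subsetUr.
have bec : forall w, w \in cone f ->
    lin (be w) c = if w \in [set Some v | v in f] then 3^-1 else 0.
  by apply: (barycentric_coef ai bt (c := fun=> 3^-1) sub); rewrite sum_some.
have becN : lin (be None) c = 0 by rewrite bec ?(negPf (None_notin f)) // !inE.
have becS v : v \in f -> lin (be (Some v)) c = 3^-1.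
  by move=> vf; have vi := imset_f Some vf; rewrite bec ?vi // (subsetP sub).
have beqN : lin (be None) q = 1.
  rewrite (@barycentric_coef _ _ p' (cone f) be ai bt [set None] (fun=> 1)) ?big_set1 ?scale1r //.
  - by rewrite set11.
  - by rewrite sub1set !inE.
  - by rewrite !inE.
(* If [g] contained the barycentre [c], so would the common face, and uniqueness of coordinates
   would give 0 instead of 1/3 at a vertex of [f] outside [g]. *)
have nh g : g \in triangles K -> g != f -> ~ hull p g c.
  move=> gT gf hg; have [gK' cg] := triangleP gT.
  have hf : hull p f c by exists (fun=> 3^-1); split.
  have [d [d0 d1 cE]] : hull p (f :&: g) c by rewrite -(gK.2 f g).
  have /subsetPn[v vf vg] : ~~ (f \subset g).
    by apply: contra gf => fg; rewrite eq_sym eqEcard fg cf cg.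
  have := @affine_coef_uniq _ _ p f (fun=> 3^-1) (fun v => if v \in f :&: g then d v else 0)
    (gK.1 f fK) _ _ v vf.
  rewrite -sum_sub1 ?subsetIl // -sum_sub ?subsetIl // s1 d1 -cE => /(_ erefl erefl).
  by rewrite inE (negPf vg) andbF => /eqP; rewrite invr_eq0 pnatr_eq0.
have near1 : \forall x \near c, forall v, v \in f -> 0 < lin (be (Some v)) x.
  apply: open_nbhs_nbhs; split; first exact: (@interior_open f (fun v => be (Some v))).
  by move=> v vf; rewrite becS // invr_gt0.
have near2 : \forall x \near c, forall g, g \in triangles K -> g != f -> ~ hull p g x.
  apply: (@filter_forall _ _ (fun (g : {set V}) y =>
    g \in triangles K -> g != f -> ~ hull p g y) (nbhs c)) => g.
  have [gT|gT] := boolP (g \in triangles K); last by exact: nearW.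
  have [gf|gf] := eqVneq g f; first by exact: nearW.
  by apply: filterS (near_not_hull gT (nh g gT gf)).
have : nbhs c (fun x => (forall v, v \in f -> 0 < lin (be (Some v)) x) /\
    forall g, g \in triangles K -> g != f -> ~ hull p g x) by apply: filterI.
move=> /nbhs_ballP[e /= e0 eP].
have oB : open (ball c e) by apply: ball_open.
have [d d0 dP] := open_line q oB (ballxx c e0).
(* On the line from [c] to [q] the apex coordinate is the parameter itself; its sign tells the two
   sides of [f] apart, and [a], [b] are chosen on opposite sides. *)
have beL r : lin (be None) (line c q r) = r by rewrite lin_line becN beqN add0r subr0 mulr1.
have [||a [Ba a0] ga] := @generic_dense _ _ p' (fun x => ball c e x /\ 0 < lin (be None) x)
    (line c q (d / 2)).
- by apply: openI => //; apply: open_lin_gt0.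
- split; last by rewrite beL divr_gt0.
  by apply: dP; rewrite gtr0_norm ?divr_gt0 //; lra.
have [||b [Bb b0] [gab _]] := @generic_pair_dense _ _ p' a a
    (fun x => ball c e x /\ lin (be None) x < 0) (line c q (- (d / 2))) ga ga.
- by apply: openI => //; apply: open_lin_lt0.
- split; last by rewrite beL oppr_lt0 divr_gt0.
  by apply: dP; rewrite normrN gtr0_norm ?divr_gt0 //; lra.
exists a, b; split=> //; last first.
  move=> g gT gf; apply/asboolP => -[r [r01 hg]].
  have [_ h2] := eP _ (ball_convex Ba Bb r01); exact: (h2 g gT gf hg).
pose A := lin (be None) a; pose B := lin (be None) b.
have AB : 0 < A - B by rewrite subr_gt0; apply: lt_trans b0 a0.
(* Root of the affine function running from [A > 0] to [B < 0]. *)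
have r01 : 0 <= A / (A - B) <= 1.
  apply/andP; split; first by apply: divr_ge0; apply: ltW.
  by rewrite ler_pdivrMr // mul1r lerDl oppr_ge0 ltW.
apply/asboolP; exists (A / (A - B)); split=> //.
have [h1 _] := eP _ (ball_convex Ba Bb r01).
apply/(hull_cone_barycentric _ fT bt); split=> [|v vf]; last exact/ltW/h1.
by rewrite lin_line -/A -/B -[B - A]opprB mulrN divfK ?subrr // gt_eqF.
Qed.

(** * Homological consequences of the crossing counts *)

Lemma inside_count t x S : generic p x -> S \subset tetrahedra K -> t \in tetrahedra K ->
  hull p t x -> \big[addb/false]_(u in S) inh p u x = (t \in S).
Proof.
move=> gx SK tK hx; have [tS|tS] := boolP (t \in S); last first.
  rewrite big1 // => u uS; apply/asboolP => hu.
  by case/negP: tS; rewrite (tetrahedron_uniq gx tK (subsetP SK _ uS) hx hu).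
rewrite (big_setD1 t) //= [inh p t x](asboolT hx) big1 // => u; rewrite !inE => /andP[ut uS].
apply/asboolP => hu; case/negP: ut.
by rewrite (tetrahedron_uniq gx tK (subsetP SK _ uS) hx hu).
Qed.

Lemma tetrahedra_segment S a b : S \subset tetrahedra K -> generic_segment p a b ->
  \big[addb/false]_(t in S) inh p t a (+) \big[addb/false]_(t in S) inh p t b =
  \big[addb/false]_(f : {set V} | #|f| == 3%N) (bd S f && hits p a b f).
Proof.
move=> SK gab; rewrite -big_split -(sum_boundary (fun e => hits p a b e)) => [|t tS]; last first.
  by have [] := tetrahedronP (subsetP SK t tS).
apply: eq_bigr => t tS; have [tK ct] := tetrahedronP (subsetP SK t tS).
by apply: segment_parity => //; apply: gK.1.
Qed.

Lemma bd_triangle S f : S \subset tetrahedra K -> #|f| = 3%N -> bd S f -> f \in triangles K.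
Proof.
move=> SK cf; apply: contraTT => fT; rewrite /bd big1 // => t tS.
apply: contraNF fT => ft; apply: (facet_triangle cf _ ft).
by have [] := tetrahedronP (subsetP SK t tS).
Qed.

(** The probe crosses [f] and no other triangle, so each tetrahedron on [f] contains exactly one
    end, and each end lies in at most one tetrahedron. *)
Lemma geometric_pseudomanifold : pseudomanifold K.
Proof.
move=> f cf; have [fT|fT] := boolP (f \in triangles K); last first.
  rewrite (_ : [set _ in _ | _] = set0) ?cards0 //; apply/setP => t; rewrite !inE.
  apply/negbTE; apply: contra fT => /andP[/andP[tK _] ft]; exact: facet_triangle ft.
have [a [b [/generic_segment_some gab hf nh]]] := probe fT.
have one x : generic p x -> (#|[set t in tetrahedra K | inh p t x]| <= 1)%N.
  move=> gx; apply/card_le1_eqP => t t'; rewrite !in_set =>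
    /andP[tK /asboolP hx] /andP[t'K /asboolP hx'].
  apply: (tetrahedron_uniq gx) => //; by rewrite in_set.
have [ga gb _] := gab.
apply: leq_trans (leq_add (one a ga) (one b gb)).
apply: leq_trans (leq_card_setU _ _); apply/subset_leq_card/subsetP => t.
rewrite in_set => /andP[tT ft].
have inE' x : (t \in [set t in tetrahedra K | inh p t x]) = inh p t x by rewrite in_set tT.
rewrite in_setU !inE'.
have [tK ct] := tetrahedronP tT.
suff : inh p t a (+) inh p t b by case: (inh p t a); case: (inh p t b).
rewrite segment_parity //; last exact: gK.1.
rewrite (sum_facets _ ct) (bigD1 f) ?cf ?eqxx //= hf big1 // => g /andP[/andP[/eqP cg gt] gf].
by apply: nh => //; apply: facet_triangle gt.
Qed.

Lemma generic_in_tetrahedron t : t \in tetrahedra K -> exists2 x, generic p' x & hull p t x.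
Proof.
move=> tT; have [tK ct] := tetrahedronP tT.
have ai := gK.1 t tK; have [b bt] := barycentric_exists ct ai.
have s1 : \sum_(v in t) 4^-1 = 1 :> R by rewrite sumr_const ct -[LHS]mulr_natl mulfV // pnatr_eq0.
have [||x xt gx] := @generic_dense _ _ p' (fun w => forall v, v \in t -> 0 < lin (b v) w)
    (\sum_(v in t) 4^-1 *: p v).
- exact: interior_open.
- move=> v vt; rewrite (barycentric_coef ai bt (subxx t) s1 erefl) // vt invr_gt0 //.
exists x => //; apply/(hull_barycentric ai bt _ (subxx t)).
by split=> [v ->//|v vt]; apply/ltW/xt.
Qed.

(** A generic segment from inside a member of [S] to a distant point changes the count of enclosing
    tetrahedra, so it crosses the boundary of [S]. *)
Lemma geometric_no_three_cycle : no_three_cycle K.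
Proof.
move=> S SK /set0Pn[t tS]; apply: contrapT => no.
have tT := subsetP SK t tS; have [a ga ha] := generic_in_tetrahedron tT.
pose B := \sum_v `|p v|.
have oM : open (fun w : pt => B < `|w|).
  apply: (@open_comp _ _ (fun w : pt => `|w|) (fun r : R => B < r)); last exact: open_gt.
  by move=> w _; apply: norm_continuous.
have far : B < `|const_mx (B + 1) : pt|.
  apply: lt_le_trans (coord_le_norm _ ord0); rewrite mxE.
  by apply: lt_le_trans (ler_norm _); rewrite ltrDl.
have [b Bb [/generic_segment_some gab _]] := generic_pair_dense ga ga oM far.
have := tetrahedra_segment SK gab.
rewrite (inside_count _ SK tT ha) ?tS; last exact: generic_some ga.
rewrite big1 => [|u uS]; last by apply/asboolP => /hull_bounded; rewrite leNgt Bb.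
rewrite big1 // => f /eqP cf; case bf: (bd S f) => //=.
by case: no; exists f.
Qed.

Lemma geometric_bounding : closed (realization K p) ->
  homeomorphic (realization K p) (@closed_ball3 R) -> bounding K.
Proof.
move=> clX hX z zK zc.
pose S := [set t in tetrahedra K | `[< exists x, [/\ generic p' x, hull p t x & winding z x] >]].
have SK : S \subset tetrahedra K by apply/subsetP => t; rewrite in_set => /andP[].
have count x : generic p' x -> \big[addb/false]_(t in S) inh p t x = winding z x.
  move=> gx; have [[t tT hx]|no] := pselect (exists2 t, t \in tetrahedra K & hull p t x).
    rewrite (inside_count (generic_some gx) SK tT hx) in_set tT /=.
    apply/asboolP/idP => [[y [gy hy wy]]|wx]; last by exists x.
    by rewrite (winding_tetrahedron zK zc tT gx gy).
  rewrite big1 => [|t tS].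
    rewrite winding_outside // => -[s /= sK hs].
    have s4 := K4 sK; move: s4; rewrite leq_eqVlt => /orP[/eqP cs|s3].
      by apply: no; exists s => //; rewrite inE sK cs.
    by apply: (generic_some gx (g := s)) => //; apply: hull_aff.
  by apply/asboolP => hx; apply: no; exists t => //; apply: (subsetP SK).
exists S => // f cf; have [fT|fT] := boolP (f \in triangles K); last first.
  rewrite [RHS](contraNF (subsetP zK f) fT).
  by apply: contraNF fT => /(bd_triangle SK cf).
(* Along the probe through [f] the count over [S] jumps by [bd S f] and the parity of [z] by the
   membership of [f]; by [count] the two jumps agree. *)
have [a [b [gab hf nh]]] := probe fT; have [ga gb _] := gab.
have := tetrahedra_segment SK (generic_segment_some gab).
rewrite !count // (winding_segment zK zc gab).
rewrite [RHS](bigD1 f) ?cf //= hf andbT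
  [X in _ (+) X]big1 ?addbF => [<-|g /andP[/eqP cg gf]]; last first.
  by case bg: (bd S g) => //=; apply: nh => //; apply: bd_triangle bg.
have [fz|fz] := boolP (f \in z); last first.
  rewrite big1 // => g gz; apply: nh; first exact: (subsetP zK).
  by apply: contraNneq fz => <-.
rewrite (big_setD1 f) //= hf big1 // => g; rewrite !inE => /andP[gf gz].
by apply: nh => //; apply: (subsetP zK).
Qed.

End Homology.

Theorem theorem6 (R : realType) (V : finType) (K : {set {set V}})
    (p : V -> 'rV[R]_3) :
  is_simplicial_complex K -> all_vertices K -> dim3 K ->
  geometric_complex K p ->
  closed_lipschitz_domain (realization K p) ->
  homeomorphic (realization K p) (@closed_ball3 R) ->
  ((exists T : {set {set V}}, spanning_tree K T /\ stt_terminates K T)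
   <-> collapsible K).
Proof.
move=> cK vK [K4 [s0 s0K cs0]] gK [clX _ _ _ _] hX; split; last exact: collapsible_stt.
move=> [T [sT tT]].
(* The apex is put in general position so that its cone over every triangle is nondegenerate. *)
have [q _ gq] := @generic_dense R V p setT 0%R openT I.
apply: (stt_collapsible cK vK K4 _ _ _ _ sT tT).
- have : 0 < #|s0| by rewrite cs0.
  by move=> /card_gt0P[v _]; exists v.
- exact: (geometric_bounding cK K4 gK gq).
- exact: (geometric_no_three_cycle q gK).
- exact: (geometric_pseudomanifold cK gK gq).
Qed.
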